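(* For each $X\in\mathbb{P}_m$, the map $\Phi_X:\mathbb{R}\times\mathcal{P}^1(\mathbb{P}_m)\to\mathcal{P}^1(\mathbb{P}_m)$, $\Phi_X(t,\mu)=X\#_t\mu$, is continuous (with $\mathcal{P}^1(\mathbb{P}_m)$ carrying the metric $d_1^W$) and satisfies $$\Phi_X(ts,\mu)=\Phi_X(s,\Phi_X(t,\mu)),\qquad t,s\in\mathbb{R},\ \mu\in\mathcal{P}^1(\mathbb{P}_m).$$ Moreover, for fixed $\mu\in\mathcal{P}^1(\mathbb{P}_m)$, the map $t\in\mathbb{R}\mapsto X\#_t\mu$ is locally Lipschitz with respect to $d_1^W$: for every $T>0$ there is a constant $C_T>0$ such that $d_1^W(X\#_t\mu,X\#_s\mu)\le C_T|t-s|$ for all $t,s\in[-T,T]$.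
   Context: $\mathbb{P}_m$ denotes the set of $m\times m$ complex positive definite matrices, with the Riemannian distance $d(A,B)=\|\log(A^{-1/2}BA^{-1/2})\|_2$, where $\|Z\|_2=(\mathrm{tr}\,Z^2)^{1/2}$. For $A,B\in\mathbb{P}_m$ and $t\in\mathbb{R}$, $A\#_tB:=A^{1/2}(A^{-1/2}BA^{-1/2})^tA^{1/2}$. $\mathcal{P}^1(\mathbb{P}_m)$ is the set of Borel probability measures $\mu$ on $\mathbb{P}_m$ with $\int_{\mathbb{P}_m}d(Z,W)\,d\mu(Z)<\infty$ for some (equivalently all) $W\in\mathbb{P}_m$. $X\#_t\mu$ denotes the push-forward of $\mu$ under $A\mapsto X\#_tA$. The $1$-Wasserstein distance is $d_1^W(\mu,\nu)=\inf_{\pi}\int d(A,B)\,d\pi(A,B)$, the infimum over all couplings $\pi$ of $\mu$ and $\nu$. *)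

(* Defs.v *)
From HB Require Import structures.
From mathcomp Require Import all_boot all_order all_algebra.
From mathcomp Require Import all_classical all_reals all_analysis.
From mathcomp Require Import complex.

Set Implicit Arguments.
Unset Strict Implicit.
Unset Printing Implicit Defensive.

Import Order.TTheory GRing.Theory Num.Theory.
Local Open Scope ring_scope.
Local Open Scope classical_set_scope.

Definition adjm {R : realType} {p q : nat} (A : 'M[R[i]]_(p, q)) : 'M[R[i]]_(q, p) :=
  map_mx (@conjc R) A^T.

Definition posdef {R : realType} {m : nat} (A : 'M[R[i]]_m) : Prop :=
  adjm A = A /\
  forall v : 'cV[R[i]]_m, v != 0 -> 0 < (adjm v *m A *m v) 0 0.

Definition unitarymx {R : realType} {m : nat} (U : 'M[R[i]]_m) : Prop :=
  adjm U *m U = 1%:M.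

Definition spec_dec {R : realType} {m : nat} (A : 'M[R[i]]_m)
  (p : 'M[R[i]]_m * 'rV[R]_m) : Prop :=
  unitarymx p.1 /\
  A = p.1 *m diag_mx (map_mx (real_complex R) p.2) *m adjm p.1.

(* functional calculus f(A) = U diag(f(d)) U^* for a Hermitian matrix A,
   using a (chosen) spectral decomposition; independent of the choice. *)
Definition mxfun {R : realType} {m : nat} (f : R -> R) (A : 'M[R[i]]_m)
  : 'M[R[i]]_m :=
  match pselect (exists p, spec_dec A p) with
  | left h => let p := proj1_sig (cid h) in
      p.1 *m diag_mx (map_mx (fun x => real_complex R (f x)) p.2) *m adjm p.1
  | right _ => 0
  end.

Definition powm {R : realType} {m : nat} (t : R) (A : 'M[R[i]]_m) :=
  mxfun (fun x => x `^ t) A.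
Definition logm {R : realType} {m : nat} (A : 'M[R[i]]_m) := mxfun (@ln R) A.

Definition gmean {R : realType} {m : nat} (A B : 'M[R[i]]_m) (t : R) :=
  powm (2^-1) A *m powm t (powm (- 2^-1) A *m B *m powm (- 2^-1) A)
    *m powm (2^-1) A.

Definition riem_dist {R : realType} {m : nat} (A B : 'M[R[i]]_m) : R :=
  let Z := logm (powm (- 2^-1) A *m B *m powm (- 2^-1) A) in
  Num.sqrt (complex.Re (\tr (Z *m Z))).

Definition Pmpred {R : realType} {m : nat} : pred 'M[R[i]]_m :=
  fun A => `[< posdef A >].
Definition Pm (R : realType) (m : nat) := {A : 'M[R[i]]_m | Pmpred A}.
HB.instance Definition _ R m := [isSub of Pm R m for @proj1_sig _ (@Pmpred R m)].
HB.instance Definition _ R m := [Choice of Pm R m by <:].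

Lemma posdef1 (R : realType) (m : nat) : posdef (1%:M : 'M[R[i]]_m).
Proof.
split.
  by apply/matrixP => i j; rewrite !mxE eq_sym conjc_nat.
move=> v v0; rewrite mulmx1 mxE.
have [i vi] : exists i, v i 0 != 0.
  apply/existsP; apply: contraR v0 => /existsPn H; apply/eqP/matrixP => i j.
  by rewrite (ord1 j) mxE; apply/eqP; move/negPn: (H i).
rewrite (bigD1 i) //= ltr_pwDl //.
  rewrite !mxE lt_def mulf_neq0 //= ?conjc_eq0 // mulrC; exact: mulcJ_ge0.
by apply: sumr_ge0 => k _; rewrite !mxE mulrC; exact: mulcJ_ge0.
Qed.

Definition Pm_one (R : realType) (m : nat) : Pm R m :=
  exist (@Pmpred R m) 1%:M (asboolT (posdef1 R m)).

HB.instance Definition _ (R : realType) (m : nat) :=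
  isPointed.Build (Pm R m) (Pm_one R m).

Definition dP {R : realType} {m : nat} (A B : Pm R m) : R :=
  riem_dist (val A) (val B).

Definition dopen {R : realType} {m : nat} : set (set (Pm R m)) :=
  [set U | forall x, U x -> exists2 e : R, 0 < e & [set y | dP x y < e] `<=` U].

Definition PmB (R : realType) (m : nat) := g_sigma_algebraType (@dopen R m).

(* X #_t A as a map P_m -> P_m (the fallback X is never used, since
   X #_t A is positive definite) *)
Definition gmeanP {R : realType} {m : nat} (X A : Pm R m) (t : R) : Pm R m :=
  insubd X (gmean (val X) (val A) t).

Local Open Scope ereal_scope.

Definition P1 {R : realType} {m : nat} (mu : set (PmB R m) -> \bar R) : Prop :=
  (exists P : probability (PmB R m) R, forall A, P A = mu A) /\
  (exists W : PmB R m, \int[mu]_Z (dP Z W)%:E < +oo).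

Definition Phi {R : realType} {m : nat} (X : Pm R m) (t : R)
  (mu : set (PmB R m) -> \bar R) : set (PmB R m) -> \bar R :=
  pushforward mu (fun A : PmB R m => (gmeanP X A t : PmB R m)).

Definition coupling {R : realType} {m : nat} (mu nu : set (PmB R m) -> \bar R)
  (pi : probability (PmB R m * PmB R m)%type R) : Prop :=
  (forall A : set (PmB R m), measurable A -> pi (fst @^-1` A) = mu A) /\
  (forall A : set (PmB R m), measurable A -> pi (snd @^-1` A) = nu A).

Definition W1 {R : realType} {m : nat} (mu nu : set (PmB R m) -> \bar R) : \bar R :=
  ereal_inf [set \int[pi]_z (dP z.1 z.2)%:E | pi in [set pi | coupling mu nu pi]].

(* Main.v *)
(* Write [N Z] for the Frobenius norm of [log Z] and [^H] for the adjoint.  Any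
   two positive definite matrices are of the form [P P^H] and [P Z P^H], and then
   their distance is [N Z].  This gives the symmetry of [d], the flow identity and
   [d (X #_s A) (X #_t A) = |t - s| d X A].

   For the triangle inequality [N (P Z P^H) <= N (P P^H) + N Z], with
   [Z = U e^D U^H], let [g t = N (P U e^{tD} U^H P^H)^2].  Functions of two
   Hermitian matrices are compared through the doubly stochastic matrix of
   squared overlaps of their eigenvectors, which reduces first order expansions
   of traces and Lipschitz bounds to scalar estimates; it gives
   [g' t <= 2 N (P U e^{tD} U^H P^H) |D|], hence the claim after integration.
   The same device shows that [A |-> X #_t A] is continuous.

   That map is in general not Lipschitz when [|t| > 1], because geodesics spread
   exponentially, so a coupling of small cost is not sent to a coupling whose
   cost is bounded by a multiple of it.  Instead, outside of a set on which
   [d X] has small integral against the fixed limit measure, the map is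
   continuous at a uniform scale, and elsewhere
   [d (X #_t A) (X #_t0 B) <= |t| d X A + |t0| d X B] is integrated. *)
Require Import Defs.
From HB Require Import structures.
From mathcomp Require Import all_boot all_order all_algebra.
From mathcomp Require Import all_classical all_reals all_analysis.
From mathcomp Require Import complex.
From mathcomp Require Import measurable_realfun lra ring.
From mathcomp Require spectral.
Import Order.TTheory GRing.Theory Num.Theory.
Import numFieldNormedType.Exports.
Local Open Scope ring_scope.
Local Open Scope classical_set_scope.
Set Implicit Arguments.
Unset Strict Implicit.
Unset Printing Implicit Defensive.

(** * Functional calculus of Hermitian matrices *)

Section HermitianCalculus.
Context {R : realType}.
Local Notation C := R[i].
Local Notation toC := (real_complex R).
Local Notation unitary := Defs.unitarymx.

Lemma adjmE p q (A : 'M[C]_(p, q)) i j : adjm A i j = conjc (A j i).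
Proof. by rewrite !mxE. Qed.

Lemma adjmK p q (A : 'M[C]_(p, q)) : adjm (adjm A) = A.
Proof. by apply/matrixP => i j; rewrite !adjmE conjcK. Qed.

Lemma adjm_mul p q r (A : 'M[C]_(p, q)) (B : 'M[C]_(q, r)) :
  adjm (A *m B) = adjm B *m adjm A.
Proof. by rewrite /adjm trmx_mul map_mxM. Qed.

Lemma adjmB p q (A B : 'M[C]_(p, q)) : adjm (A - B) = adjm A - adjm B.
Proof. by apply/matrixP => i j; rewrite !(mxE, raddfB). Qed.

Lemma adjm1 m : adjm (1%:M : 'M[C]_m) = 1%:M.
Proof. by rewrite /adjm trmx1 map_mx1. Qed.

Section Dimension.
Variable m : nat.
Implicit Types (U V P Q A B Z : 'M[C]_m) (d e : 'rV[R]_m).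

Definition dg d : 'M[C]_m := diag_mx (map_mx toC d).

Lemma dgE d i j : dg d i j = toC (d 0 i) *+ (i == j).
Proof. by rewrite !mxE. Qed.

Lemma adjm_dg d : adjm (dg d) = dg d.
Proof.
apply/matrixP => i j; rewrite adjmE !dgE eq_sym.
by case: eqP => [->|_]; rewrite ?mulr1n ?mulr0n ?conjc_real ?conjc0.
Qed.

Lemma dg_mul d e : dg d *m dg e = dg (\row_k (d 0 k * e 0 k)).
Proof.
rewrite /dg mulmx_diag; congr diag_mx.
by apply/matrixP => i j; rewrite !mxE rmorphM.
Qed.

Lemma dg1 : dg (const_mx 1) = 1%:M.
Proof. by apply/matrixP => i j; rewrite dgE !mxE; case: eqP. Qed.

Lemma unitary1 : unitary (1%:M : 'M[C]_m).
Proof. by rewrite /Defs.unitarymx adjm1 mulmx1. Qed.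

Lemma unitary_adjmr U : unitary U -> U *m adjm U = 1%:M.
Proof. exact: mulmx1C. Qed.

Lemma unitary_adjm U : unitary U -> unitary (adjm U).
Proof. by move=> /unitary_adjmr; rewrite /Defs.unitarymx adjmK. Qed.

Lemma unitary_mul U V : unitary U -> unitary V -> unitary (U *m V).
Proof.
rewrite /Defs.unitarymx => hU hV.
by rewrite adjm_mul mulmxA -(mulmxA (adjm V)) hU mulmx1 hV.
Qed.

End Dimension.
End HermitianCalculus.

(** [U] need not be unitary: for invertible [M], [sdm M d] is a congruence of a diagonal matrix, the
    form in which geodesics appear below. *)
HB.lock Definition sdm {R : realType} {m : nat} (U : 'M[R[i]]_m) (d : 'rV[R]_m)
  : 'M[R[i]]_m := U *m dg d *m adjm U.

Section SpectralCalculus.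
Context {R : realType} {m : nat}.
Local Notation C := R[i].
Local Notation toC := (real_complex R).
Local Notation unitary := Defs.unitarymx.
Implicit Types (U V P Q A B Z : 'M[C]_m) (d e : 'rV[R]_m) (s t : R).

Lemma sdmE U d : sdm U d = U *m dg d *m adjm U.
Proof. by rewrite sdm.unlock. Qed.

Lemma adjm_sdm U d : adjm (sdm U d) = sdm U d.
Proof. by rewrite !sdmE !adjm_mul adjmK adjm_dg mulmxA. Qed.

Lemma sdm_mul U d e : unitary U ->
  sdm U d *m sdm U e = sdm U (\row_k (d 0 k * e 0 k)).
Proof.
move=> hU; rewrite !sdmE -dg_mul !mulmxA.
by rewrite -(mulmxA _ (adjm U) U) hU mulmx1.
Qed.

Lemma sdm_conj U V d : sdm (V *m U) d = V *m sdm U d *m adjm V.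
Proof. by rewrite !sdmE adjm_mul !mulmxA. Qed.

Lemma sdm1 U : unitary U -> sdm U (const_mx 1) = 1%:M.
Proof. by move=> hU; rewrite !sdmE dg1 mulmx1 unitary_adjmr. Qed.

(* Entrywise, [P i j * d j = e i * P i j] says [d j = e i] wherever [P i j != 0]. *)
Lemma dg_intertwine (f : R -> R) P d e :
  P *m dg d = dg e *m P -> P *m dg (map_mx f d) = dg (map_mx f e) *m P.
Proof.
move=> /matrixP H; apply/matrixP => i j; move: (H i j).
rewrite !mul_mx_diag !mul_diag_mx !mxE => hij.
case: (eqVneq (P i j) 0) => [->|Pij]; first by rewrite mul0r mulr0.
rewrite mulrC; congr (_ * _); congr (toC (f _)).
by move: hij; rewrite mulrC => /(mulIf Pij)/complexI.
Qed.

(** The matrix [V^H U] intertwines the two diagonal matrices, hence also their images under [f].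
    This makes [mxfun] independent of the chosen decomposition. *)
Lemma sdm_map_uniq (f : R -> R) U V d e : unitary U -> unitary V ->
  sdm U d = sdm V e -> sdm U (map_mx f d) = sdm V (map_mx f e).
Proof.
move=> hU hV H.
have : adjm V *m U *m dg d = dg e *m (adjm V *m U).
  have -> : adjm V *m U *m dg d = adjm V *m sdm U d *m U.
    by rewrite !sdmE -!mulmxA hU mulmx1.
  by rewrite H !sdmE !mulmxA hV mul1mx.
move/(dg_intertwine f) => E.
rewrite !sdmE.
have -> : U *m dg (map_mx f d) = V *m (adjm V *m U *m dg (map_mx f d)).
  by rewrite !mulmxA unitary_adjmr // mul1mx.
by rewrite E !mulmxA -(mulmxA _ U) unitary_adjmr // mulmx1.
Qed.

Lemma mxfun_sdm (f : R -> R) U d : unitary U ->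
  mxfun f (sdm U d) = sdm U (map_mx f d).
Proof.
move=> hU; rewrite /mxfun; case: pselect => [h|]; last first.
  by case; exists (U, d); split; [exact: hU|exact: sdmE].
case: (cid h) => -[V e] /= [/= hV E].
have -> : diag_mx (map_mx (fun x => toC (f x)) e) = dg (map_mx f e).
  by rewrite /dg -map_mx_comp.
rewrite -sdmE; apply: sdm_map_uniq => //.
by rewrite E -sdmE.
Qed.

Lemma hermitian_sdm A : adjm A = A ->
  exists U d, unitary U /\ A = sdm U d.
Proof.
move=> hA.
have adjE p q (B : 'M[C]_(p, q)) : map_mx Num.conj B^T = adjm B by [].
have Ah : A \is hermitianmx m false Num.conj.
  by apply/is_hermitianmxP; rewrite expr0 scale1r; symmetry.
have /spectral.orthomx_spectralP E := spectral.hermitian_normalmx Ah.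
have := spectral.hermitian_spectral_diag_real Ah.
have := spectral.spectral_unitarymx A.
set U := spectral.spectralmx A in E *.
set D := spectral.spectral_diag A in E *.
move=> hU hD.
(* The equation [E] reads [A = U^-1 D U], so it is the adjoint of [spectralmx A] that carries the
   eigenvectors as columns. *)
have uU : unitary (adjm U).
  by rewrite /Defs.unitarymx adjmK; apply/spectral.unitarymxP.
have VE : invmx U = adjm U by exact: spectral.invmx_unitary.
have DE : dg (map_mx (@complex.Re R) D) = diag_mx D.
  congr diag_mx; apply/rowP => j; rewrite 2!mxE RRe_real //.
  by move/mxOverP: hD; apply.
exists (adjm U), (map_mx (@complex.Re R) D); split; first exact: uU.
by rewrite !sdmE DE adjmK -VE; exact: E.
Qed.

Lemma quadratic_dg d (w : 'cV[C]_m) :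
  (adjm w *m dg d *m w) 0 0 = \sum_k toC (d 0 k) * (w k 0 * conjc (w k 0)).
Proof.
rewrite mul_mx_diag mxE; apply: eq_bigr => k _; rewrite !mxE.
by rewrite mulrAC mulrC; congr (_ * _); exact: mulrC.
Qed.

Lemma posdefP A : posdef A <->
  exists U d, [/\ unitary U, forall k, 0 < d 0 k & A = sdm U d].
Proof.
split=> [[/hermitian_sdm[U [d [hU ->]]] hpos]|[U [d [hU d0 ->]]]].
  exists U, d; split => // k.
  (* On the eigenvector [U *m w] the quadratic form takes the value [d 0 k]. *)
  pose w : 'cV[C]_m := delta_mx k 0.
  have wn0 : U *m w != 0.
    apply/eqP => /(congr1 (mulmx (adjm U))); rewrite mulmxA hU mul1mx mulmx0.
    by move=> /matrixP/(_ k 0)/eqP; rewrite !mxE !eqxx oner_eq0.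
  have := hpos _ wn0.
  have -> : adjm (U *m w) *m sdm U d *m (U *m w) = adjm w *m dg d *m w.
    rewrite adjm_mul !sdmE !mulmxA -(mulmxA (adjm w)) hU mulmx1.
    by rewrite -(mulmxA _ (adjm U) U) hU mulmx1.
  rewrite quadratic_dg (bigD1 k) //= big1 ?addr0 => [|j jk].
    by rewrite !mxE conjc_nat !eqxx /= !mulr1 ltcR.
  by rewrite !mxE (negbTE jk) mul0r mulr0.
split=> [|v v0]; first exact: adjm_sdm.
pose w := adjm U *m v.
have -> : adjm v *m sdm U d *m v = adjm w *m dg d *m w.
  by rewrite /w adjm_mul adjmK !sdmE !mulmxA.
rewrite quadratic_dg.
have [k wk] : exists k, w k 0 != 0.
  apply/existsP; apply: contraR v0 => /existsPn H.
  have w0 : w = 0 by apply/matrixP => i j; rewrite (ord1 j) [RHS]mxE; apply/eqP; move/negPn: (H i).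
  by rewrite -(mul1mx v) -(unitary_adjmr hU) -mulmxA -/w w0 mulmx0.
rewrite (bigD1 k) //= ltr_pwDl //.
  rewrite mulr_gt0 ?ltcR //= lt_def mulcJ_ge0 andbT.
  by rewrite mulf_neq0 // conjc_eq0.
by apply: sumr_ge0 => i _; rewrite mulr_ge0 ?mulcJ_ge0 // lecR ltW.
Qed.

Lemma unitary_unit U : unitary U -> U \in unitmx.
Proof. by move=> hU; case: (mulmx1_unit hU). Qed.

Lemma adjm_unitmx P : (adjm P \in unitmx) = (P \in unitmx).
Proof. by rewrite /adjm map_unitmx unitmx_tr. Qed.

Lemma posdef_congr P A : P \in unitmx -> posdef A -> posdef (P *m A *m adjm P).
Proof.
move=> hP [hA posA]; split; first by rewrite !adjm_mul adjmK hA mulmxA.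
move=> v v0; have -> : adjm v *m (P *m A *m adjm P) *m v
    = adjm (adjm P *m v) *m A *m (adjm P *m v).
  by rewrite adjm_mul adjmK !mulmxA.
apply: posA; apply: contra_neq v0 => E.
by rewrite -(mul1mx v) -(mulVmx (_ : adjm P \in unitmx)) ?adjm_unitmx // -mulmxA E mulmx0.
Qed.

Lemma posdef_sdm U d : unitary U -> (forall k, 0 < d 0 k) -> posdef (sdm U d).
Proof. by move=> hU d0; apply/posdefP; exists U, d. Qed.

End SpectralCalculus.

(** * Distance and geodesics in a frame *)

HB.lock Definition mpow {R : realType} {m : nat} (t : R) (A : 'M[R[i]]_m)
  : 'M[R[i]]_m := powm t A.

HB.lock Definition mlog {R : realType} {m : nat} (A : 'M[R[i]]_m)
  : 'M[R[i]]_m := logm A.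

(* The distance from the identity matrix. *)
HB.lock Definition lognorm {R : realType} {m : nat} (Z : 'M[R[i]]_m) : R :=
  Num.sqrt (complex.Re (\tr (mlog Z *m mlog Z))).

HB.lock Definition rdist {R : realType} {m : nat} (A B : 'M[R[i]]_m) : R :=
  riem_dist A B.

Section MatrixPowers.
Context {R : realType} {m : nat}.
Local Notation C := R[i].
Local Notation toC := (real_complex R).
Local Notation unitary := Defs.unitarymx.
Implicit Types (U V P Q A B Z : 'M[C]_m) (d e : 'rV[R]_m) (s t : R).

Lemma mpow_sdm t U d : unitary U ->
  mpow t (sdm U d) = sdm U (map_mx (fun x => x `^ t) d).
Proof. by move=> hU; rewrite mpow.unlock; exact: mxfun_sdm. Qed.

Lemma mlog_sdm U d : unitary U -> mlog (sdm U d) = sdm U (map_mx (@ln R) d).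
Proof. by move=> hU; rewrite mlog.unlock; exact: mxfun_sdm. Qed.

Lemma mpow_posdef t A : posdef A -> posdef (mpow t A).
Proof.
move=> /posdefP[U [d [hU d0 ->]]]; rewrite (mpow_sdm _ _ hU).
by apply: posdef_sdm => // k; rewrite mxE powR_gt0.
Qed.

Lemma mpow_adjm t A : posdef A -> adjm (mpow t A) = mpow t A.
Proof. by move=> /(mpow_posdef t)[]. Qed.

Lemma mpowD s t A : posdef A -> mpow s A *m mpow t A = mpow (s + t) A.
Proof.
move=> /posdefP[U [d [hU d0 ->]]]; rewrite !(mpow_sdm _ _ hU) (sdm_mul _ _ hU).
congr (sdm _ _); apply/rowP => k; rewrite !mxE powRD //.
by apply/implyP => _; rewrite gt_eqF.
Qed.

Lemma mpow0 A : posdef A -> mpow 0 A = 1%:M.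
Proof.
move=> /posdefP[U [d [hU d0 ->]]]; rewrite (mpow_sdm _ _ hU) -(sdm1 hU).
by congr (sdm _ _); apply/rowP => k; rewrite !mxE powRr0.
Qed.

Lemma mpowr1 A : posdef A -> mpow 1 A = A.
Proof.
move=> /posdefP[U [d [hU d0 ->]]]; rewrite (mpow_sdm _ _ hU).
by congr (sdm _ _); apply/rowP => k; rewrite !mxE powRr1 // ltW.
Qed.

Lemma mpowrM s t A : posdef A -> mpow s (mpow t A) = mpow (t * s) A.
Proof.
move=> /posdefP[U [d [hU d0 ->]]]; rewrite !(mpow_sdm _ _ hU).
by congr (sdm _ _); apply/rowP => k; rewrite !mxE powRrM.
Qed.

Lemma mpowNV t A : posdef A -> mpow (- t) A *m mpow t A = 1%:M.
Proof. by move=> hA; rewrite mpowD // addNr mpow0. Qed.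

Lemma mpowVN t A : posdef A -> mpow t A *m mpow (- t) A = 1%:M.
Proof. by move=> hA; rewrite mpowD // subrr mpow0. Qed.

Lemma mpow_unit t A : posdef A -> mpow t A \in unitmx.
Proof. move=> /(mpowVN t)/mulmx1_unit[hu _]; exact: hu. Qed.

Lemma half_half : 2^-1 + 2^-1 = 1 :> R.
Proof. by rewrite -div1r -splitr. Qed.

Lemma mpow_half A : posdef A -> mpow 2^-1 A *m mpow 2^-1 A = A.
Proof. by move=> hA; rewrite mpowD // half_half mpowr1. Qed.

Lemma posdef_unit A : posdef A -> A \in unitmx.
Proof. by move=> hA; rewrite -(mpowr1 hA) mpow_unit. Qed.

Lemma mpow_adjm_half A : posdef A -> mpow 2^-1 A *m adjm (mpow 2^-1 A) = A.
Proof. by move=> hA; rewrite mpow_adjm // mpow_half. Qed.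

Lemma posdef_sqrt A : posdef A -> exists2 P, P \in unitmx & P *m adjm P = A.
Proof.
by move=> hA; exists (mpow 2^-1 A); [exact: mpow_unit|exact: mpow_adjm_half].
Qed.

Lemma mxtrace_sdm U d : unitary U -> \tr (sdm U d) = toC (\sum_k d 0 k).
Proof.
move=> hU; rewrite !sdmE mxtrace_mulC mulmxA hU mul1mx mxtrace_diag rmorph_sum.
by apply: eq_bigr => k _; rewrite mxE.
Qed.

Lemma lognorm_sdm U d : unitary U ->
  lognorm (sdm U d) = Num.sqrt (\sum_k ln (d 0 k) ^+ 2).
Proof.
move=> hU; rewrite lognorm.unlock (mlog_sdm _ hU) (sdm_mul _ _ hU) (mxtrace_sdm _ hU) /=.
by congr Num.sqrt; apply: eq_bigr => k _; rewrite !mxE expr2.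
Qed.

Lemma lognorm_ge0 Z : 0 <= lognorm Z.
Proof. by rewrite lognorm.unlock sqrtr_ge0. Qed.

Lemma lognorm_conj U Z : unitary U -> posdef Z ->
  lognorm (U *m Z *m adjm U) = lognorm Z.
Proof.
move=> hU /posdefP[V [d [hV d0 ->]]].
by rewrite -sdm_conj !lognorm_sdm //; apply: unitary_mul.
Qed.

Lemma lognorm_pow t Z : posdef Z -> lognorm (mpow t Z) = `|t| * lognorm Z.
Proof.
move=> /posdefP[V [d [hV d0 ->]]].
rewrite (mpow_sdm _ _ hV) !(lognorm_sdm _ hV) -sqrtr_sqr -sqrtrM ?sqr_ge0 // mulr_sumr.
by congr Num.sqrt; apply: eq_bigr => k _; rewrite mxE ln_powR exprMn.
Qed.

Lemma rdistE A B :
  rdist A B = lognorm (mpow (- 2^-1) A *m B *m mpow (- 2^-1) A).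
Proof. by rewrite rdist.unlock lognorm.unlock mlog.unlock mpow.unlock. Qed.

Lemma posdef_gram P : P \in unitmx -> posdef (P *m adjm P).
Proof. by move=> hP; have := posdef_congr hP (posdef1 R m); rewrite mulmx1. Qed.

(** This is the unitary factor of the polar decomposition of [P]. *)
Lemma polar_unitary P : P \in unitmx ->
  unitary (mpow (- 2^-1) (P *m adjm P) *m P).
Proof.
move=> /posdef_gram hA; set S := mpow _ _.
rewrite /Defs.unitarymx; apply: mulmx1C.
have -> : S *m P *m adjm (S *m P) = S *m (P *m adjm P) *m S.
  by rewrite adjm_mul (mpow_adjm _ hA) !mulmxA.
rewrite -{1}(mpow_half hA) mulmxA (mpowNV _ hA) mul1mx.
exact: mpowVN.
Qed.

(** Since [S *m P] is unitary, [S] turns the second argument into a unitary conjugate of [Z]. Any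
    factor [P] of the first argument can thus replace its square root. *)
Lemma rdist_frame P Z : P \in unitmx -> posdef Z ->
  rdist (P *m adjm P) (P *m Z *m adjm P) = lognorm Z.
Proof.
move=> hP hZ; have hU := polar_unitary hP; rewrite rdistE; set S := mpow _ _ in hU *.
have -> : S *m (P *m Z *m adjm P) *m S = (S *m P) *m Z *m adjm (S *m P).
  by rewrite adjm_mul (mpow_adjm _ (posdef_gram hP)) !mulmxA.
exact: lognorm_conj.
Qed.

Lemma posdef_frame Q A : Q \in unitmx -> posdef A ->
  exists2 Z, posdef Z & A = Q *m Z *m adjm Q.
Proof.
move=> hQ hA; exists (invmx Q *m A *m adjm (invmx Q)).
  by apply: posdef_congr => //; rewrite unitmx_inv.
by rewrite -!mulmxA -adjm_mul (mulmxV hQ) adjm1 mulmx1 mulmxA (mulmxV hQ) mul1mx.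
Qed.

Lemma lognorm1 : lognorm (1%:M : 'M[C]_m) = 0.
Proof.
have U1 := @unitary1 R m.
rewrite -(sdm1 U1) (lognorm_sdm _ U1) big1 ?sqrtr0 // => k _.
by rewrite mxE ln1 expr0n.
Qed.

Lemma rdistxx A : posdef A -> rdist A A = 0.
Proof.
move=> hA; have [P hP <-] := posdef_sqrt hA.
by have := rdist_frame hP (posdef1 R m); rewrite mulmx1 lognorm1.
Qed.

Lemma rdist_frame_pow P Z s t : P \in unitmx -> posdef Z ->
  rdist (P *m mpow s Z *m adjm P) (P *m mpow t Z *m adjm P)
    = `|t - s| * lognorm Z.
Proof.
(* The frame is recentred at time [s]: [Q Q^H = P Z^s P^H], and in the frame [Q] the time [t]
   becomes [t - s]. *)
move=> hP hZ; pose Q := P *m mpow (s / 2) Z.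
have QE r : Q *m mpow r Z *m adjm Q = P *m mpow (r + s) Z *m adjm P.
  have -> : r + s = s / 2 + r + s / 2 by lra.
  rewrite -!(mpowD _ _ hZ) /Q adjm_mul (mpow_adjm _ hZ).
  by rewrite !mulmxA.
have -> : P *m mpow s Z *m adjm P = Q *m adjm Q.
  by rewrite -{1}(mulmx1 Q) -(mpow0 hZ) QE add0r.
have -> : P *m mpow t Z *m adjm P = Q *m mpow (t - s) Z *m adjm Q.
  by rewrite QE subrK.
rewrite rdist_frame; [exact: lognorm_pow| |exact: mpow_posdef].
by rewrite unitmx_mul hP (mpow_unit _ hZ).
Qed.

(** Both points lie on one curve [P Z^r P^H], at the times 0 and 1, and the distance formula along
    it is symmetric in time. *)
Lemma rdistC A B : posdef A -> posdef B -> rdist A B = rdist B A.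
Proof.
move=> hA hB; have [P hP AE] := posdef_sqrt hA.
have [Z hZ BE] := posdef_frame hP hB.
have {}AE : A = P *m mpow 0 Z *m adjm P by rewrite (mpow0 hZ) mulmx1.
have {}BE : B = P *m mpow 1 Z *m adjm P by rewrite (mpowr1 hZ).
by rewrite AE BE !(rdist_frame_pow _ _ hP hZ) distrC.
Qed.

Lemma gmeanE A B t : gmean A B t = mpow 2^-1 A *m
  mpow t (mpow (- 2^-1) A *m B *m mpow (- 2^-1) A) *m mpow 2^-1 A.
Proof. by rewrite mpow.unlock. Qed.

Lemma gmean_posdef A B t : posdef A -> posdef B -> posdef (gmean A B t).
Proof.
move=> hA hB; have h1 := mpow_unit 2^-1 hA; have h2 := mpow_unit (- 2^-1) hA.
rewrite gmeanE -{2}(mpow_adjm 2^-1 hA); apply: posdef_congr => //.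
by apply: mpow_posdef; rewrite -{2}(mpow_adjm (- 2^-1) hA); apply: posdef_congr.
Qed.

(** In the frame [A^(1/2)] the weighted mean with [A] is the plain power [Z |-> Z^t]; the flow
    identity and the speed of the flow follow from this. *)
Lemma gmean_frame A Z t : posdef A -> posdef Z ->
  gmean A (mpow 2^-1 A *m Z *m adjm (mpow 2^-1 A)) t
    = mpow 2^-1 A *m mpow t Z *m adjm (mpow 2^-1 A).
Proof.
move=> hA hZ; rewrite gmeanE (mpow_adjm 2^-1 hA) !mulmxA (mpowNV _ hA) mul1mx.
by rewrite -(mulmxA Z) (mpowVN _ hA) mulmx1.
Qed.

Lemma gmeanM A B s t : posdef A -> posdef B ->
  gmean A (gmean A B t) s = gmean A B (t * s).
Proof.
move=> hA hB; have [Z hZ ->] := posdef_frame (mpow_unit 2^-1 hA) hB.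
by rewrite !(gmean_frame _ hA) ?(mpowrM _ _ hZ); [exact: erefl|exact: hZ|exact: mpow_posdef|exact: hZ].
Qed.

Lemma rdist_gmean A B s t : posdef A -> posdef B ->
  rdist (gmean A B s) (gmean A B t) = `|t - s| * rdist A B.
Proof.
move=> hA hB; have hP := mpow_unit 2^-1 hA.
have [Z hZ ->] := posdef_frame hP hB.
rewrite !(gmean_frame _ hA hZ) (rdist_frame_pow _ _ hP hZ); congr (_ * _).
by have := rdist_frame hP hZ; rewrite (mpow_adjm_half hA) => ->.
Qed.

End MatrixPowers.

(** * Eigenvector overlaps *)

HB.lock Definition rtr {R : realType} {m : nat} (A : 'M[R[i]]_m) : R :=
  complex.Re (\tr A).

(* The square of the Frobenius norm, for Hermitian [A]. *)
HB.lock Definition hsq {R : realType} {m : nat} (A : 'M[R[i]]_m) : R :=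
  rtr (A *m A).

Section Overlap.
Context {R : realType} {m : nat}.
Local Notation C := R[i].
Local Notation toC := (real_complex R).
Local Notation unitary := Defs.unitarymx.
Implicit Types (U V P Q A B Z : 'M[C]_m) (d e : 'rV[R]_m) (s t : R).

Lemma dg_mulE d A i j : (dg d *m A) i j = toC (d 0 i) * A i j.
Proof. by rewrite mul_diag_mx !mxE. Qed.

Lemma rtrB A B : rtr (A - B) = rtr A - rtr B.
Proof. by rewrite rtr.unlock !raddfB. Qed.

Lemma rtr_mulC A B : rtr (A *m B) = rtr (B *m A).
Proof. by rewrite rtr.unlock mxtrace_mulC. Qed.

Lemma rtr_mulBl A B Z : rtr ((A - B) *m Z) = rtr (A *m Z) - rtr (B *m Z).
Proof. by rewrite mulmxBl rtrB. Qed.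

Lemma rtrE A : rtr A = \sum_i complex.Re (A i i).
Proof. by rewrite rtr.unlock /mxtrace raddf_sum. Qed.

Lemma hsqE A : hsq A = rtr (A *m A).
Proof. by rewrite hsq.unlock. Qed.

Lemma hsqB A B : hsq (A - B) = hsq A - 2 * rtr (A *m B) + hsq B.
Proof.
rewrite !hsqE mulmxBl !mulmxBr !rtrB (rtr_mulC B A).
by move: (rtr _) (rtr _) (rtr _) => x y z; ring.
Qed.

(* [|<u_i, v_j>|^2] for the columns [u_i] of [U] and [v_j] of [V]. *)
Definition overlap U V i j : R :=
  complex.Re ((adjm U *m V) i j * conjc ((adjm U *m V) i j)).

Lemma mulcJ_Re (z : C) : z * conjc z = toC (complex.Re (z * conjc z)).
Proof. by rewrite [RHS]RRe_real // ger0_real // mulcJ_ge0. Qed.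

Lemma overlap_ge0 U V i j : 0 <= overlap U V i j.
Proof. by rewrite -(lecR 0) /overlap -mulcJ_Re mulcJ_ge0. Qed.

Lemma overlap_sumr U V i : unitary U -> unitary V -> \sum_j overlap U V i j = 1.
Proof.
move=> hU hV; apply: (@complexI R); rewrite rmorph_sum rmorph1.
have hW := unitary_mul (unitary_adjm hU) hV.
have <- : ((adjm U *m V) *m adjm (adjm U *m V)) i i = 1.
  by rewrite (unitary_adjmr hW) mxE eqxx.
rewrite mxE; apply: eq_bigr => j _; rewrite adjmE; apply: esym; exact: mulcJ_Re.
Qed.

Lemma overlapC U V i j : overlap V U i j = overlap U V j i.
Proof.
rewrite /overlap; set W := adjm U *m V.
have -> : adjm V *m U = adjm W by rewrite adjm_mul adjmK.
by rewrite adjmE conjcK mulrC.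
Qed.

Lemma overlap_suml U V j : unitary U -> unitary V -> \sum_i overlap U V i j = 1.
Proof.
move=> hU hV; rewrite -[RHS](overlap_sumr j hV hU).
by apply: eq_bigr => i _; rewrite overlapC.
Qed.

Lemma rtr_mul_cycle P Q A B Z W :
  rtr (P *m A *m Q *m (Z *m B *m W)) = rtr (A *m (Q *m Z) *m (B *m (W *m P))).
Proof. by rewrite -!mulmxA rtr_mulC -!mulmxA. Qed.

(** With [W = U^H V] the trace is that of [dg d W dg e W^H], where the entries of [W] occur only
    through their squared moduli. *)
Lemma rtr_sdm_mul U V d e :
  rtr (sdm U d *m sdm V e) = \sum_i \sum_j overlap U V i j * (d 0 i * e 0 j).
Proof.
rewrite !sdmE rtr_mul_cycle rtrE; apply: eq_bigr => i _.
have -> : adjm V *m U = adjm (adjm U *m V) by rewrite adjm_mul adjmK.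
rewrite mxE raddf_sum; apply: eq_bigr => j _.
rewrite !dg_mulE adjmE /overlap; set w := (_ *m _) i j.
have -> : toC (d 0 i) * w * (toC (e 0 j) * conjc w)
    = toC (complex.Re (w * conjc w) * (d 0 i * e 0 j)).
  by rewrite mulrACA mulcJ_Re -!rmorphM mulrC.
by [].
Qed.

(** Unit row sums spread a sum over one spectrum over pairs of eigenvalues, so that it can be
    compared term by term with mixed traces. *)
Lemma overlap_pair_l (f : 'I_m -> R) U V : unitary U -> unitary V ->
  \sum_i f i = \sum_i \sum_j overlap U V i j * f i.
Proof.
move=> hU hV; apply: eq_bigr => i _.
by rewrite -mulr_suml overlap_sumr // mul1r.
Qed.

Lemma overlap_pair_r (f : 'I_m -> R) U V : unitary U -> unitary V ->
  \sum_j f j = \sum_i \sum_j overlap U V i j * f j.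
Proof.
move=> hU hV; rewrite exchange_big /=; apply: eq_bigr => j _.
by rewrite -mulr_suml overlap_suml // mul1r.
Qed.

Lemma rtr_sdm U d : unitary U -> rtr (sdm U d) = \sum_k d 0 k.
Proof. by move=> hU; rewrite rtr.unlock (mxtrace_sdm _ hU). Qed.

Lemma hsq_sdm U d : unitary U -> hsq (sdm U d) = \sum_k d 0 k ^+ 2.
Proof.
move=> hU; rewrite hsqE (sdm_mul _ _ hU) (rtr_sdm _ hU).
by apply: eq_bigr => k _; rewrite mxE expr2.
Qed.

Lemma hsq_sub_sdm U V d e : unitary U -> unitary V ->
  hsq (sdm U d - sdm V e) = \sum_i \sum_j overlap U V i j * (d 0 i - e 0 j) ^+ 2.
Proof.
move=> hU hV; rewrite hsqB (hsq_sdm _ hU) (hsq_sdm _ hV) rtr_sdm_mul.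
rewrite (overlap_pair_l (fun i => d 0 i ^+ 2) hU hV).
rewrite (overlap_pair_r (fun i => e 0 i ^+ 2) hU hV).
rewrite mulr_sumr -sumrN -!big_split /=; apply: eq_bigr => i _.
rewrite mulr_sumr -sumrN -!big_split /=; apply: eq_bigr => j _.
by ring.
Qed.

(** All terms are spread over pairs of eigenvalues. When [g] is the derivative of [f], the
    right-hand side averages scalar Taylor remainders. *)
Lemma trace_taylor (f g : R -> R) U V d e : unitary U -> unitary V ->
  \sum_k f (d 0 k) - \sum_k f (e 0 k)
    - rtr ((sdm U d - sdm V e) *m sdm V (map_mx g e))
  = \sum_i \sum_j overlap U V i j *
      (f (d 0 i) - f (e 0 j) - (d 0 i - e 0 j) * g (e 0 j)).
Proof.
move=> hU hV; rewrite rtr_mulBl rtr_sdm_mul (sdm_mul _ _ hV) (rtr_sdm _ hV).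
have -> : \sum_k (\row_k (e 0 k * map_mx g e 0 k)) 0 k = \sum_k e 0 k * g (e 0 k).
  by apply: eq_bigr => k _; rewrite !mxE.
rewrite (overlap_pair_l (fun k => f (d 0 k)) hU hV).
rewrite (overlap_pair_r (fun k => f (e 0 k)) hU hV).
rewrite (overlap_pair_r (fun k => e 0 k * g (e 0 k)) hU hV).
rewrite -!sumrB; apply: eq_bigr => i _; rewrite -!sumrB; apply: eq_bigr => j _.
by rewrite mxE; ring.
Qed.

(** Row [i] of the overlaps is a probability vector averaging [(d 0 i - e 0 j) ^+ 2]; if every gap
    were at least [c], this row alone would contribute [c ^+ 2]. *)
Lemma near_eigenvalue U V d e i (c : R) : unitary U -> unitary V -> 0 <= c ->
  hsq (sdm U d - sdm V e) < c ^+ 2 -> exists j, `|d 0 i - e 0 j| < c.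
Proof.
move=> hU hV c0; rewrite hsq_sub_sdm // => H; apply: contrapT => /forallNP N.
have : c ^+ 2 <= \sum_j overlap U V i j * (d 0 i - e 0 j) ^+ 2.
  rewrite -[leLHS]mul1r -(overlap_sumr i hU hV) mulr_suml.
  apply: ler_sum => j _; apply: ler_wpM2l; first exact: overlap_ge0.
  by rewrite -[leRHS]real_normK ?num_real // lerXn2r ?nnegrE // leNgt; apply/negP/N.
apply/negP; rewrite -ltNge; apply: le_lt_trans H.
rewrite [leRHS](bigD1 i) //= lerDl sumr_ge0 // => k _; apply: sumr_ge0 => j _.
by rewrite mulr_ge0 ?overlap_ge0 ?sqr_ge0.
Qed.

(** With the Gram matrix [G] of [M = P W], the left side is the sum of [d_i d_j |G i j|^2] and
    [hsq (adjm P *m P)] is the sum of [|G i j|^2]; moreover [d_i d_j <= (d_i^2 + d_j^2) / 2]. *)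
Lemma hsq_congr P (W : 'M[C]_m) d : unitary W ->
  hsq (P *m sdm W d *m adjm P) <= (\sum_k d 0 k ^+ 2) * hsq (adjm P *m P).
Proof.
move=> hW; set M := P *m W; set G := adjm M *m M.
have GC i j : G j i = conjc (G i j) by rewrite -adjmE /G adjm_mul adjmK.
have GE : hsq (adjm P *m P) = \sum_i \sum_j complex.Re (G i j * conjc (G i j)).
  have -> : hsq (adjm P *m P) = hsq G.
    rewrite !hsqE /G /M adjm_mul -!mulmxA [RHS]rtr_mulC -!mulmxA.
    by rewrite (unitary_adjmr hW) mulmx1 (mulmxA W) (unitary_adjmr hW) mul1mx.
  rewrite hsqE rtrE; apply: eq_bigr => i _.
  by rewrite mxE raddf_sum; apply: eq_bigr => j _; rewrite (GC i j).
have -> : hsq (P *m sdm W d *m adjm P)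
    = \sum_i \sum_j d 0 i * d 0 j * complex.Re (G i j * conjc (G i j)).
  have -> : P *m sdm W d *m adjm P = M *m dg d *m adjm M.
    by rewrite /M adjm_mul sdmE !mulmxA.
  rewrite hsqE rtr_mul_cycle rtrE -/G; apply: eq_bigr => i _.
  rewrite mxE raddf_sum; apply: eq_bigr => j _.
  rewrite !dg_mulE (GC i j); set w := G i j.
  have -> : toC (d 0 i) * w * (toC (d 0 j) * conjc w)
      = toC (d 0 i * d 0 j * complex.Re (w * conjc w)).
    by rewrite mulrACA mulcJ_Re -!rmorphM.
  by [].
rewrite GE mulr_sumr; apply: ler_sum => i _; rewrite mulr_sumr; apply: ler_sum => j _.
apply: ler_wpM2r; first by rewrite -(lecR 0) -mulcJ_Re mulcJ_ge0.
have sq_le k : d 0 k ^+ 2 <= \sum_k d 0 k ^+ 2.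
  by rewrite (bigD1 k) //= lerDl sumr_ge0 // => l _; rewrite sqr_ge0.
have := sq_le i; have := sq_le j; have := sqr_ge0 (d 0 i - d 0 j); nra.
Qed.

Lemma cauchy_schwarz (I : finType) (w x y : I -> R) : (forall i, 0 <= w i) ->
  (\sum_i w i * (x i * y i)) ^+ 2
    <= (\sum_i w i * x i ^+ 2) * (\sum_i w i * y i ^+ 2).
Proof.
move=> w0; set X := \sum_i w i * x i ^+ 2; set Y := \sum_i w i * y i ^+ 2.
set Z := \sum_i _.
have quad (l : R) : 0 <= X - 2 * l * Z + l ^+ 2 * Y.
  rewrite (_ : _ + _ = \sum_i w i * (x i - l * y i) ^+ 2).
    by apply: sumr_ge0 => i _; rewrite mulr_ge0 ?sqr_ge0.
  rewrite /X /Y /Z !mulr_sumr -!sumrN -!big_split /=.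
  by apply: eq_bigr => i _; ring.
have Y0 : 0 <= Y by apply: sumr_ge0 => i _; rewrite mulr_ge0 ?sqr_ge0.
have [Y1|Y1] := eqVneq Y 0.
  rewrite Y1 mulr0; have [->|Z0] := eqVneq Z 0; first by rewrite expr0n.
  (* For [Y = 0] the quadratic is affine in [l], and this [l] gives it the value -1. *)
  have := quad ((X + 1) / (2 * Z)).
  rewrite Y1 (_ : _ + _ = - 1) ?oppr_ge0 ?ler10 //; by field.
(* The minimizer of the quadratic. *)
have := quad (Z / Y).
rewrite (_ : _ + _ = (X * Y - Z ^+ 2) / Y); last by field.
by rewrite pmulr_lge0 ?invr_gt0 ?lt_def ?Y1 // subr_ge0.
Qed.

(** Cauchy-Schwarz with the overlaps as weights; their unit marginals reduce both factors to sums
    over a single spectrum. *)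
Lemma rtr_sdm_le U V d e : unitary U -> unitary V ->
  rtr (sdm U d *m sdm V e)
    <= Num.sqrt (\sum_k d 0 k ^+ 2) * Num.sqrt (\sum_k e 0 k ^+ 2).
Proof.
move=> hU hV; rewrite rtr_sdm_mul pair_big /=.
have := @cauchy_schwarz _ (fun p : 'I_m * 'I_m => overlap U V p.1 p.2)
  (fun p => d 0 p.1) (fun p => e 0 p.2) (fun p => overlap_ge0 U V _ _).
rewrite -(pair_big xpredT xpredT (fun i j => overlap U V i j * d 0 i ^+ 2)) /=.
rewrite -(pair_big xpredT xpredT (fun i j => overlap U V i j * e 0 j ^+ 2)) /=.
rewrite -(overlap_pair_l (fun i => d 0 i ^+ 2) hU hV).
rewrite -(overlap_pair_r (fun i => e 0 i ^+ 2) hU hV) => H.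
rewrite -sqrtrM; last by apply: sumr_ge0 => k _; rewrite sqr_ge0.
apply: le_trans (ler_norm _) _; rewrite -sqrtr_sqr; exact: ler_wsqrtr.
Qed.

End Overlap.

(** * The triangle inequality *)

Section DerivativeTools.
Context {R : realType}.

Lemma lnsq_taylor (x c : R) : 0 < x -> 0 < c -> exists2 K, 0 <= K &
  (* With [r = y / x] and [l = ln r], the remainder is [l^2 + 2 ln x (l - (r - 1))], and both
     summands are of order [(r - 1)^2]. The number [q] below bounds [r^-1], since
     [x / y <= x / c]. *)
  forall y, c <= y ->
    `|ln y ^+ 2 - ln x ^+ 2 - (y - x) * (2 * ln x / x)| <= K * (y - x) ^+ 2.
Proof.
move=> x0 c0; pose q := 1 + x / c.
have q1 : 1 <= q by rewrite lerDl divr_ge0 // ltW.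
exists ((q ^+ 2 + 2 * `|ln x| * q) / x ^+ 2).
  by rewrite divr_ge0 ?sqr_ge0 // addr_ge0 ?sqr_ge0 // !mulr_ge0 //; lra.
move=> y cy; have y0 : 0 < y by lra.
pose r := y / x; have r0 : 0 < r by rewrite divr_gt0.
have qr : r^-1 <= q.
  rewrite /r invf_div /q; apply: le_trans (_ : x / c <= _); last by rewrite lerDr.
  by rewrite ler_pM2l // lef_pV2 ?posrE.
pose l := ln r.
have lE : ln y = l + ln x by rewrite /l /r ln_div ?posrE // subrK.
have l1 : l <= r - 1.
  by have := @le_ln1Dx _ (r - 1); rewrite subrKC; apply; lra.
have l2 : - l <= r^-1 - 1.
  have ri : 0 < r^-1 by rewrite invr_gt0.
  have := @le_ln1Dx _ (r^-1 - 1); rewrite subrKC lnV ?posrE // => H.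
  by apply: H; lra.
have q0 : 0 <= q by lra.
have rV : r * r^-1 = 1 by rewrite mulfV // gt_eqF.
have gap1 : l - (r - 1) <= 0 by lra.
have gap2 : - ((r - 1) ^+ 2 * q) <= l - (r - 1).
  have H : (r - 1) ^+ 2 * r^-1 = r - 2 + r^-1 by nra.
  have : (r - 1) ^+ 2 * r^-1 <= (r - 1) ^+ 2 * q by rewrite ler_wpM2l ?sqr_ge0.
  by rewrite H; lra.
have sq : l ^+ 2 <= (r - 1) ^+ 2 * q ^+ 2.
  rewrite -exprMn -ler_sqrt ?sqr_ge0 // !sqrtr_sqr normrM (ger0_norm q0).
  have [r1|r1] := leP 1 r.
    rewrite (@ger0_norm _ (r - 1)) ?subr_ge0 // ger0_norm.
      by apply: le_trans l1 _; rewrite ler_peMr ?subr_ge0.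
    have : r^-1 <= 1 by rewrite invf_le1.
    lra.
  rewrite (@ltr0_norm _ (r - 1)) ?subr_lt0 // ltr0_norm; last by lra.
  have : (1 - r) * r^-1 <= (1 - r) * q by rewrite ler_wpM2l // subr_ge0 ltW.
  by rewrite opprB; nra.
have xn0 : x != 0 by rewrite gt_eqF.
have -> : ln y ^+ 2 - ln x ^+ 2 - (y - x) * (2 * ln x / x)
    = l ^+ 2 + 2 * ln x * (l - (r - 1)) by rewrite lE /r; field.
have -> : (q ^+ 2 + 2 * `|ln x| * q) / x ^+ 2 * (y - x) ^+ 2
    = (r - 1) ^+ 2 * q ^+ 2 + 2 * `|ln x| * ((r - 1) ^+ 2 * q) by rewrite /r; field.
apply: le_trans (ler_normD _ _) _; apply: lerD.
  by rewrite ger0_norm ?sqr_ge0.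
rewrite !normrM (@ger0_norm _ 2) // ler_wpM2l ?mulr_ge0 // ler0_norm //.
by rewrite lerNl.
Qed.

Lemma is_derive_ext (f g : R -> R) (t l : R) :
  f =1 g -> is_derive t 1 f l -> is_derive t 1 g l.
Proof. by move=> /funext ->. Qed.

Lemma is_derive_addc (f : R -> R) (a t l : R) :
  is_derive t 1 f l -> is_derive t 1 (fun s => f s + a) l.
Proof.
by move=> df; rewrite -[l]addr0; exact: is_deriveD df (is_derive_cst a t 1).
Qed.

Lemma is_derive_mulc (f : R -> R) (a t l : R) :
  is_derive t 1 f l -> is_derive t 1 (fun s => f s * a) (l * a).
Proof.
move=> df; rewrite mulrC; have := @is_deriveZ _ _ _ f a t 1 l df.
by apply: is_derive_ext => s; exact: mulrC.
Qed.

(** The difference quotients of [g - q] are dominated by those of [G], which tend to 0. *)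
Lemma is_derive_squeeze (g q G : R -> R) (t l : R) :
  is_derive t 1 q l -> is_derive t 1 G 0 -> G t = 0 -> g t = q t ->
  (\forall s \near t, `|g s - q s| <= G s) -> is_derive t 1 g l.
Proof.
move=> dq dG Gt gt near_le.
have -> : g = q + (g - q) by apply/funext => s; rewrite !fctE subrKC.
rewrite -[l]addr0; apply: is_deriveD.
have H : (fun h : R => h^-1 *: ((g - q) (h *: 1 + t) - (g - q) t)) @ 0^' --> (0 : R).
  have : (fun h : R => h^-1 *: (G (h *: 1 + t) - G t)) @ 0^' --> 'D_1 G t.
    exact: (@ex_derive _ _ _ _ _ _ _ dG).
  rewrite derive_val Gt => /cvgrPdist_lt cG.
  apply/cvgrPdist_lt => e e0; near=> h.
  have : `|0 - h^-1 *: (G (h *: 1 + t) - 0)| < e by near: h; exact: cG.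
  apply: le_lt_trans; rewrite !sub0r !normrN !normrZ ler_wpM2l // !fctE gt subrr !subr0.
  apply: le_trans (ler_norm _); near: h.
  have nt : \forall s \near t, `|g s - q s| <= G s by [].
  have sh : (fun h : R => h *: 1 + t) @ 0^' --> t.
    rewrite -[X in _ --> X]add0r -[X in _ --> X + _](scale0r (1 : R)).
    apply: cvgD; last exact: cvg_cst.
    apply: cvgZr_tmp; exact: cvg_within.
  exact: sh nt.
apply: DeriveDef; first by apply/cvg_ex; exists 0; exact: H.
exact: cvg_lim H.
Unshelve. all: by end_near.
Qed.

End DerivativeTools.

Section LogNormTriangle.
Context {R : realType} {m : nat}.
Local Notation C := R[i].
Local Notation toC := (real_complex R).
Local Notation unitary := Defs.unitarymx.
Implicit Types (U V P Q A B Z M : 'M[C]_m) (d e h : 'rV[R]_m) (s t : R).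

Lemma sdm_mulmx1 M d : sdm M d = M *m sdm 1%:M d *m adjm M.
Proof. by rewrite -sdm_conj mulmx1. Qed.

Lemma sdmB M d e : sdm M d - sdm M e = sdm M (d - e).
Proof.
rewrite !sdmE -mulmxBl -mulmxBr; congr (_ *m _ *m _).
by apply/matrixP => i j; rewrite !(dgE, mxE) rmorphB mulrnBl.
Qed.

Lemma rtr_sdm_mulmx M d B :
  rtr (sdm M d *m B) = \sum_k d 0 k * complex.Re ((adjm M *m B *m M) k k).
Proof.
have -> : rtr (sdm M d *m B) = rtr (dg d *m (adjm M *m B *m M)).
  by rewrite sdmE -!mulmxA rtr_mulC -!mulmxA.
rewrite rtrE; apply: eq_bigr => k _; rewrite dg_mulE.
by move: ((_ *m _) k k) => [x y] /=; rewrite mul0r subr0.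
Qed.

Lemma posdef_sdm_unit M d : M \in unitmx -> (forall k, 0 < d 0 k) -> posdef (sdm M d).
Proof.
move=> hM d0; rewrite sdm_mulmx1; apply: posdef_congr => //.
exact: posdef_sdm (unitary1 m) d0.
Qed.

Lemma row_lower_bound d : (forall k, 0 < d 0 k) ->
  exists2 c : R, 0 < c & forall k, c <= d 0 k.
Proof.
move=> d0; have S0 : 0 <= \sum_k (d 0 k)^-1.
  by apply: sumr_ge0 => k _; rewrite invr_ge0 ltW.
(* The summand 1 keeps the bound positive when [m = 0]. *)
exists (1 + \sum_k (d 0 k)^-1)^-1; first by rewrite invr_gt0 ltr_pwDl.
move=> k; rewrite -[leRHS]invrK lef_pV2 ?posrE ?invr_gt0 ?ltr_pwDl //.
rewrite (bigD1 k) //= addrCA lerDl addr_ge0 //.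
by apply: sumr_ge0 => j _; rewrite invr_ge0 ltW.
Qed.

Lemma lognorm_sdm_sqr U d : unitary U ->
  lognorm (sdm U d) ^+ 2 = \sum_k ln (d 0 k) ^+ 2.
Proof.
move=> hU; rewrite (lognorm_sdm _ hU) sqr_sqrtr //.
by apply: sumr_ge0 => k _; rewrite sqr_ge0.
Qed.

(* The gradient of [lognorm ^+ 2] at [sdm V e] is [sdm V (2 * ln e / e)]. *)
Lemma lognorm_sqr_taylor V e : unitary V -> (forall k, 0 < e 0 k) ->
  exists2 K : R, 0 <= K & exists2 c : R, 0 < c & forall A, posdef A ->
  hsq (A - sdm V e) < c ->
  `|lognorm A ^+ 2 - lognorm (sdm V e) ^+ 2
    - rtr ((A - sdm V e) *m sdm V (map_mx (fun x => 2 * ln x / x) e))|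
     <= K * hsq (A - sdm V e).
Proof.
move=> hV e0; have [c c0 ce] := row_lower_bound e0.
(* Each eigenvalue of [A] will be within [c / 2] of some [e 0 k >= c], hence at least [c / 2], where
   the scalar estimate applies. *)
have c20 : 0 < c / 2 by lra.
have /choice[K HK] : forall j, exists K : R, 0 <= K /\ forall y, c / 2 <= y ->
  `|ln y ^+ 2 - ln (e 0 j) ^+ 2 - (y - e 0 j) * (2 * ln (e 0 j) / e 0 j)|
    <= K * (y - e 0 j) ^+ 2.
  by move=> j; have [K K0 HK] := lnsq_taylor (e0 j) c20; exists K.
exists (\sum_j K j); first by apply: sumr_ge0 => j _; have [] := HK j.
exists ((c / 2) ^+ 2); first by rewrite exprn_gt0.
move=> A /posdefP[U [d [hU d0 ->]]] close.
rewrite (lognorm_sdm_sqr _ hU) (lognorm_sdm_sqr _ hV).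
rewrite (trace_taylor (fun x => ln x ^+ 2) (fun x => 2 * ln x / x) _ _ hU hV).
rewrite (hsq_sub_sdm _ _ hU hV) mulr_sumr; apply: le_trans (ler_norm_sum _ _ _) _.
apply: ler_sum => i _; rewrite mulr_sumr; apply: le_trans (ler_norm_sum _ _ _) _.
apply: ler_sum => j _; rewrite normrM (ger0_norm (overlap_ge0 _ _ _ _)) [leRHS]mulrCA.
apply: ler_wpM2l; first exact: overlap_ge0.
have [Kj0 HKj] := HK j.
have [k hk] := near_eigenvalue i hU hV (ltW c20) close.
apply: le_trans (HKj _ _) _; first by have := ce k; move: hk; rewrite ltr_norml => /andP[]; lra.
apply: ler_wpM2r; first exact: sqr_ge0.
by rewrite (bigD1 j) //= lerDl sumr_ge0 // => l _; have [] := HK l.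
Qed.

(** For invertible [M], the geodesic starting at [M M^H] with constant speed [|h|]. With [M = P U]
    it is the curve [P U e^{tD} U^H P^H]. *)
Definition geod M h t : 'M[C]_m := sdm M (\row_k expR (t * h 0 k)).

Lemma geod_posdef M h t : M \in unitmx -> posdef (geod M h t).
Proof. by move=> hM; apply: posdef_sdm_unit => // k; rewrite mxE expR_gt0. Qed.

Lemma hsq_geod_le M h s t : hsq (geod M h s - geod M h t)
  <= hsq (adjm M *m M) * \sum_k (expR (s * h 0 k) - expR (t * h 0 k)) ^+ 2.
Proof.
rewrite /geod sdmB sdm_mulmx1; apply: le_trans (hsq_congr _ _ (unitary1 m)) _.
by rewrite mulrC le_eqVlt; apply/predU1P; left; congr (_ * _); apply: eq_bigr => k _; rewrite !mxE.
Qed.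

Lemma is_derive_sumr (f : 'I_m -> R -> R) (df : 'I_m -> R) (t : R) :
  (forall k, is_derive t 1 (f k) (df k)) ->
  is_derive t 1 (fun s => \sum_k f k s) (\sum_k df k).
Proof.
move=> H; have -> : (fun s => \sum_k f k s) = \sum_k f k.
  by apply/funext => s; rewrite fct_sumE.
exact: is_derive_sum.
Qed.

Lemma is_derive_exprow (t a : R) :
  is_derive t 1 (fun s : R => expR (s * a)) (a * expR (t * a)).
Proof.
have d1 : is_derive t 1 (fun s : R => s * a) a.
  by rewrite -[X in is_derive _ _ _ X]mul1r; exact: is_derive_mulc (is_derive_id t 1).
have := @is_derive1_comp _ expR (fun s : R => s * a) t _ _ (is_derive_expR (t * a)) d1.
by rewrite mulrC.
Qed.

Lemma is_derive_geod_bound h t : is_derive t 1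
  (fun s : R => \sum_k (expR (s * h 0 k) - expR (t * h 0 k)) ^+ 2) 0.
Proof.
rewrite [X in is_derive _ _ _ X](_ : 0 = \sum_(k < m) 0); last by rewrite big1.
apply: is_derive_sumr => k.
have d1 : is_derive t 1 (fun s : R => expR (s * h 0 k) - expR (t * h 0 k))
    (h 0 k * expR (t * h 0 k)).
  exact: is_derive_addc (is_derive_exprow _ _).
have := is_deriveX 2 d1.
rewrite /= subrr expr1 mulr0 scale0r.
by apply: is_derive_ext => s; rewrite exprfctE.
Qed.

(* With the unitary [W = (P P^H)^(-1/2) P] from the polar decomposition, the left
   hand side is the trace of [sdm W h * (2 * log (P P^H))]. *)
Lemma lognorm_grad_le P e V h : P \in unitmx -> unitary V ->
  (forall k, 0 < e 0 k) -> sdm V e = P *m adjm P ->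
  rtr (sdm P h *m sdm V (map_mx (fun x => 2 * ln x / x) e))
    <= 2 * lognorm (sdm V e) * Num.sqrt (\sum_k h 0 k ^+ 2).
Proof.
move=> hP hV e0 E; have hA := posdef_sdm hV e0.
have hU := polar_unitary hP; rewrite -E in hU; set S := mpow _ _ in hU.
have SE : S = sdm V (map_mx (fun x => x `^ (- 2^-1)) e) by apply: mpow_sdm.
have ST : adjm S = S := mpow_adjm _ hA.
pose L := sdm V (\row_k (2 * ln (e 0 k))).
have -> : sdm V (map_mx (fun x => 2 * ln x / x) e) = S *m L *m adjm S.
  rewrite ST SE /L !(sdm_mul _ _ hV); congr (sdm _ _); apply/rowP => k.
  rewrite !mxE [RHS]mulrAC -powRD; last by rewrite (gt_eqF (e0 k)) implybT.
  have -> : - 2^-1 + - 2^-1 = -1 :> R by lra.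
  by rewrite powR_inv1 ?ltW // mulrC.
have -> : rtr (sdm P h *m (S *m L *m adjm S)) = rtr (sdm (S *m P) h *m L).
  by rewrite sdm_conj ST -!mulmxA [RHS]rtr_mulC -!mulmxA.
apply: le_trans (rtr_sdm_le _ _ hU hV) _; rewrite mulrC le_eqVlt; apply/predU1P; left.
congr (_ * _); rewrite (lognorm_sdm _ hV).
rewrite (_ : \sum_k _ = 2 ^+ 2 * \sum_k ln (e 0 k) ^+ 2); last first.
  by rewrite mulr_sumr; apply: eq_bigr => k _; rewrite mxE exprMn.
by rewrite sqrtrM ?sqr_ge0 // sqrtr_sqr ger0_norm.
Qed.

(** By [lognorm_sqr_taylor] at time [t], the squared norm equals a combination of exponentials up to
    an error whose bound vanishes at [t] together with its derivative. *)
Lemma is_derive_lognorm_geod M h t : M \in unitmx ->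
  exists2 D, is_derive t 1 (fun s => lognorm (geod M h s) ^+ 2 : R) D
    & D <= 2 * lognorm (geod M h t) * Num.sqrt (\sum_k h 0 k ^+ 2).
Proof.
move=> hM; have [V [e [hV e0 BE]]] := (posdefP _).1 (geod_posdef h t hM).
have [K K0 [c c0 HK]] := lognorm_sqr_taylor hV e0.
set F := sdm V (map_mx _ _) in HK.
pose w k := complex.Re ((adjm M *m F *m M) k k).
pose D := \sum_k h 0 k * expR (t * h 0 k) * w k.
pose Q := hsq (adjm M *m M).
pose S s := \sum_k (expR (s * h 0 k) - expR (t * h 0 k)) ^+ 2 : R.
have St : S t = 0 by rewrite /S big1 // => k _; rewrite subrr expr0n.
have dS : is_derive t 1 S 0 := is_derive_geod_bound h t.
have dG a : is_derive t 1 (fun s => S s * a) 0.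
  by rewrite -(mul0r a); exact: is_derive_mulc.
exists D.
  apply: (@is_derive_squeeze _ _
    (fun s => \sum_k (expR (s * h 0 k) - expR (t * h 0 k)) * w k
       + lognorm (geod M h t) ^+ 2)
    (fun s => S s * (K * Q)) t D _ (dG (K * Q))).
  - apply: is_derive_addc; apply: is_derive_sumr => k.
    exact: is_derive_mulc (is_derive_addc _ (is_derive_exprow _ _)).
  - by rewrite /= St mul0r.
  - by rewrite /= big1 ?add0r // => k _; rewrite subrr mul0r.
  have cS : (fun s => S s * Q) @ t --> (0 : R).
    have -> : (0 : R) = S t * Q by rewrite St mul0r.
    by have /derivable1_diffP/differentiable_continuous := @ex_derive _ _ _ _ _ _ _ (dG Q).
  have : \forall s \near t, S s * Q < c by apply: cvgr_lt cS _ c0.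
  apply: filterS => s Ss.
  have le := hsq_geod_le M h s t; rewrite -/Q -/(S s) mulrC in le.
  have := HK _ (geod_posdef h s hM); rewrite -BE => /(_ (le_lt_trans le Ss)) H.
  have -> : \sum_k (expR (s * h 0 k) - expR (t * h 0 k)) * w k
      = rtr ((geod M h s - geod M h t) *m F).
    rewrite /geod sdmB rtr_sdm_mulmx; apply: eq_bigr => k _.
    by congr (_ * _); rewrite !mxE.
  by rewrite opprD addrA addrAC; apply: le_trans H _; rewrite [leRHS]mulrCA ler_wpM2l.
have -> : D = rtr (sdm M (\row_k (h 0 k * expR (t * h 0 k))) *m F).
  by rewrite rtr_sdm_mulmx; apply: eq_bigr => k _; congr (_ * _); rewrite mxE.
(* The frame [P = M *m dg E] satisfies [P P^H = geod M h t], and [sdm P h] is the velocity of the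
   geodesic at time [t], so [lognorm_grad_le] applies. *)
pose E := \row_k expR (t / 2 * h 0 k).
have EE d : M *m dg E *m dg d *m adjm (M *m dg E)
    = sdm M (\row_k (d 0 k * expR (t * h 0 k))).
  rewrite adjm_mul adjm_dg sdmE !mulmxA; congr (_ *m _).
  rewrite -!mulmxA; congr (_ *m _); rewrite !dg_mul; congr (dg _); apply/rowP => k.
  by rewrite !mxE mulrCA -expRD -mulrDl -splitr.
have hP : M *m dg E \in unitmx.
  have : posdef (M *m dg E *m adjm (M *m dg E)).
    have := EE (const_mx 1); rewrite dg1 mulmx1 => ->; apply: posdef_sdm_unit => // k.
    by rewrite !mxE mul1r expR_gt0.
  by move=> /posdef_unit; rewrite unitmx_mul => /andP[].
have := lognorm_grad_le h hP hV e0.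
rewrite -BE -EE -sdmE; apply.
have := EE (const_mx 1); rewrite dg1 mulmx1 => ->; rewrite /geod; congr (sdm _ _); apply/rowP => k.
by rewrite !mxE mul1r.
Qed.

(** The squared norm has derivative at most twice the norm times [|h|], so the norm grows at rate at
    most [|h|]; the mean value theorem on the unit interval concludes. *)
Lemma lognorm_geod_le M h : M \in unitmx ->
  lognorm (geod M h 1) <= lognorm (M *m adjm M) + Num.sqrt (\sum_k h 0 k ^+ 2).
Proof.
move=> hM; have -> : M *m adjm M = geod M h 0.
  rewrite /geod sdmE; have -> : dg (\row_k expR (0 * h 0 k)) = 1%:M :> 'M[C]_m.
    by apply/matrixP => i j; rewrite dgE !mxE mul0r expR0; case: eqP.
  by rewrite mulmx1.
set H := Num.sqrt _; have H0 : 0 <= H by exact: sqrtr_ge0.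
have /choice[D HD] : forall t, exists D : R,
    is_derive t 1 (fun s => lognorm (geod M h s) ^+ 2 : R) D
    /\ D <= 2 * lognorm (geod M h t) * H.
  by move=> t; have [D ? ?] := is_derive_lognorm_geod h t hM; exists D.
apply/ler_addgt0Pr => eps eps0.
(* The square root is not differentiable at 0, hence the shift by [eps]. *)
pose g s := lognorm (geod M h s) ^+ 2 + eps ^+ 2.
have g0 s : 0 < g s by rewrite ltr_wpDl ?sqr_ge0 // exprn_gt0.
have dg s : is_derive s 1 (Num.sqrt \o g) ((2 * Num.sqrt (g s))^-1 * D s).
  apply: is_derive1_comp; first exact: is_derive1_sqrt.
  by apply: is_derive_addc; have [] := HD s.
have [s _ ] := @MVT_segment _ (Num.sqrt \o g) _ 0 1 ler01 (fun x _ => dg x)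
  (derivable_within_continuous (fun x _ => @ex_derive _ _ _ _ _ _ _ (dg x))).
rewrite subr0 mulr1 /= => E.
have le_g x : lognorm (geod M h x) <= Num.sqrt (g x).
  rewrite -[leLHS]ger0_norm ?lognorm_ge0 // -sqrtr_sqr ler_sqrt ?(ltW (g0 _)) //.
  by rewrite /g lerDl sqr_ge0.
have le2 : Num.sqrt (g 0) <= lognorm (geod M h 0) + eps.
  have nn : 0 <= lognorm (geod M h 0) + eps by rewrite addr_ge0 ?lognorm_ge0 // ltW.
  rewrite -[leRHS](ger0_norm nn) -sqrtr_sqr ler_sqrt ?sqr_ge0 //.
  by rewrite /g; have := lognorm_ge0 (geod M h 0); nra.
suff : (2 * Num.sqrt (g s))^-1 * D s <= H by have := le_g 1; lra.
have u0 : 0 < Num.sqrt (g s) by rewrite sqrtr_gt0.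
rewrite mulrC ler_pdivrMr ?mulr_gt0 //; have [_ ] := HD s.
by have := le_g s; nra.
Qed.

Lemma lognorm_congr_le P Z : P \in unitmx -> posdef Z ->
  lognorm (P *m Z *m adjm P) <= lognorm (P *m adjm P) + lognorm Z.
Proof.
move=> hP /posdefP[U [d [hU d0 ->]]].
pose M := P *m U; pose h := \row_k ln (d 0 k).
have -> : P *m sdm U d *m adjm P = geod M h 1.
  rewrite -sdm_conj /geod; congr (sdm _ _); apply/rowP => k.
  by rewrite !mxE mul1r lnK ?posrE.
have -> : P *m adjm P = M *m adjm M.
  by rewrite /M adjm_mul mulmxA -(mulmxA P) (unitary_adjmr hU) mulmx1.
have -> : lognorm (sdm U d) = Num.sqrt (\sum_k h 0 k ^+ 2).
  by rewrite (lognorm_sdm _ hU); congr Num.sqrt; apply: eq_bigr => k _; rewrite mxE.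
by apply: lognorm_geod_le; rewrite unitmx_mul hP (unitary_unit hU).
Qed.

(** In a frame centred at [B], the points [A] and [Z] become [Y] and [W], at distance
    [N (Y^(-1/2) W Y^(-1/2))]. By [lognorm_congr_le] this is at most [N (Y^-1) + N W], and inversion
    preserves [N]. *)
Lemma rdist_triangle B A Z : posdef A -> posdef B -> posdef Z ->
  rdist A Z <= rdist A B + rdist B Z.
Proof.
move=> hA hB hZ; rewrite (rdistC hA hB); have [Q hQ QE] := posdef_sqrt hB.
have [Y hY AE] := posdef_frame hQ hA; have [W hW ZE] := posdef_frame hQ hZ.
have BA : rdist B A = lognorm Y by rewrite -QE AE; exact: rdist_frame.
have BZ : rdist B Z = lognorm W by rewrite -QE ZE; exact: rdist_frame.
pose T := mpow (- 2^-1) Y; have hT : T \in unitmx := mpow_unit (- 2^-1) hY.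
have TE : adjm T = T := mpow_adjm _ hY.
pose P := Q *m mpow 2^-1 Y.
have hP : P \in unitmx by rewrite unitmx_mul hQ (mpow_unit _ hY).
have PA : A = P *m adjm P.
  by rewrite AE /P adjm_mul !mulmxA -(mulmxA Q) (mpow_adjm _ hY) (mpow_half hY).
have PT : P *m T = Q by rewrite /P /T -mulmxA (mpowVN _ hY) mulmx1.
have PZ : Z = P *m (T *m W *m adjm T) *m adjm P.
  rewrite !mulmxA PT -(mulmxA _ (adjm T)) -adjm_mul PT; exact: ZE.
rewrite BA BZ PA PZ (rdist_frame hP (posdef_congr hT hW)).
apply: le_trans (lognorm_congr_le hT hW) _; rewrite lerD2r.
have -> : T *m adjm T = mpow (-1) Y.
  rewrite TE /T (mpowD _ _ hY); congr (mpow _ _); lra.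
by rewrite (lognorm_pow _ hY) normrN1 mul1r.
Qed.

End LogNormTriangle.

(** * Continuity of the geodesic flow *)

Section LipschitzBounds.
Context {R : realType}.
Implicit Types a b c x y t : R.

Lemma expR_lipschitz M a b : a <= M -> b <= M ->
  `|expR a - expR b| <= expR M * `|a - b|.
Proof.
wlog ab : a b / b <= a => [H aM bM|aM bM].
  have [ab|/ltW ab] := leP b a; first exact: H.
  by rewrite distrC (distrC a); exact: H.
have eM : expR a <= expR M by rewrite ler_expR.
rewrite !ger0_norm ?subr_ge0 ?ler_expR //.
have -> : expR a - expR b = expR a * (1 - expR (b - a)).
  by rewrite mulrBr mulr1 -expRD subrKC.
have := expR_ge1Dx (b - a); have := expR_gt0 a.
set E := expR (b - a) => a0 E1.
apply: (@le_trans _ _ (expR a * (a - b))); first by rewrite ler_pM2l //; lra.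
by rewrite ler_wpM2r // subr_ge0.
Qed.

Lemma ln_lipschitz c x y : 0 < c -> c <= x -> c <= y ->
  `|ln x - ln y| <= c^-1 * `|x - y|.
Proof.
move=> c0; wlog xy : x y / y <= x => [H cx cy|cx cy].
  have [xy|/ltW xy] := leP y x; first exact: H.
  by rewrite distrC (distrC x); exact: H.
have y0 : 0 < y by lra. have x0 : 0 < x by lra.
rewrite !ger0_norm ?subr_ge0 ?ler_ln ?posrE // -ln_div ?posrE //.
have := @le_ln1Dx _ (x / y - 1); rewrite subrKC => H.
apply: le_trans (H _) _; first by have := divr_gt0 x0 y0; lra.
have -> : x / y - 1 = y^-1 * (x - y) by field; rewrite gt_eqF.
by rewrite ler_wpM2r ?subr_ge0 // lef_pV2 ?posrE.
Qed.

Lemma powR_lipschitz t c b : 0 < c -> exists2 L, 0 <= L &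
  forall x y, c <= x <= b -> c <= y <= b -> `|x `^ t - y `^ t| <= L * `|x - y|.
Proof.
move=> c0; pose M := `|t| * (`|ln c| + `|ln b|).
exists (expR M * (`|t| * c^-1)).
  by rewrite !mulr_ge0 ?expR_ge0 // invr_ge0 ltW.
have leM x : c <= x <= b -> t * ln x <= M.
  move=> /andP[cx xb]; have x0 : 0 < x by lra.
  apply: le_trans (ler_norm _) _; rewrite normrM ler_wpM2l //.
  have : ln c <= ln x by rewrite ler_ln ?posrE.
  have : ln x <= ln b by rewrite ler_ln ?posrE //; lra.
  have := ler_norm (ln b); have := ler_norm (- ln c); rewrite normrN.
  have := normr_ge0 (ln b); have := normr_ge0 (ln c).
  by move=> ? ? ? ? ? ?; rewrite ler_norml; apply/andP; split; lra.
move=> x y hx hy; have /andP[cx xb] := hx; have /andP[cy yb] := hy.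
rewrite /powR !gt_eqF; [|lra|lra].
apply: le_trans (expR_lipschitz (leM _ hx) (leM _ hy)) _.
rewrite -!mulrA ler_wpM2l ?expR_ge0 // -mulrBr normrM ler_wpM2l //.
exact: ln_lipschitz.
Qed.

End LipschitzBounds.

Section PowerContinuity.
Context {R : realType} {m : nat}.
Local Notation C := R[i].
Local Notation unitary := Defs.unitarymx.
Implicit Types (U V P Q A B Z M : 'M[C]_m) (d e h : 'rV[R]_m) (s t : R).

Lemma hsq_ge0 A : adjm A = A -> 0 <= hsq A.
Proof.
move=> /hermitian_sdm[U [d [hU ->]]]; rewrite (hsq_sdm _ hU).
by apply: sumr_ge0 => k _; rewrite sqr_ge0.
Qed.

Lemma hsq_congr_le P A : adjm A = A ->
  hsq (P *m A *m adjm P) <= hsq A * hsq (adjm P *m P).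
Proof.
move=> /hermitian_sdm[U [d [hU ->]]]; rewrite (hsq_sdm _ hU).
exact: hsq_congr.
Qed.

Lemma hsq_gram_ge0 P : 0 <= hsq (adjm P *m P).
Proof. by apply: hsq_ge0; rewrite adjm_mul adjmK. Qed.

Lemma mulmx_congrB P A B : P *m (A - B) *m adjm P = P *m A *m adjm P - P *m B *m adjm P.
Proof. by rewrite mulmxBr mulmxBl. Qed.

Lemma sdm_sub1 U d : unitary U -> sdm U d - 1%:M = sdm U (d - const_mx 1).
Proof. by move=> hU; rewrite -(sdm1 hU) sdmB. Qed.

Lemma hsq_lt_of_rdist B (eta : R) : posdef B -> 0 < eta ->
  exists2 del : R, 0 < del &
  forall A, posdef A -> rdist B A < del -> hsq (A - B) < eta.
Proof.
move=> hB eta0; have [P hP <-] := posdef_sqrt hB.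
pose K := m%:R * hsq (adjm P *m P).
have K0 : 0 <= K by rewrite mulr_ge0 // hsq_gram_ge0.
(* A log-norm below [ln (1 + s)] puts the eigenvalues of [W] within [s] of 1, so
   [hsq (A - B) <= K s^2 <= K s < eta]. *)
pose s := Num.min 1 (eta / (K + 1)).
have s0 : 0 < s by rewrite lt_min ltr01 divr_gt0 // ltr_wpDl.
have s1 : s <= 1 by rewrite ge_min lexx.
have sK : s * (K + 1) <= eta by rewrite -ler_pdivlMr ?ltr_wpDl // ge_min lexx orbT.
exists (ln (1 + s)); first by rewrite ln_gt0 // ltrDl.
move=> A hA; have [W hW ->] := posdef_frame hP hA.
rewrite (rdist_frame hP hW).
have -> : P *m W *m adjm P - P *m adjm P = P *m (W - 1%:M) *m adjm P.
  by rewrite mulmx_congrB mulmx1.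
have [U [d [hU d0 ->]]] := (posdefP _).1 hW; rewrite (lognorm_sdm _ hU) => H.
rewrite (sdm_sub1 _ hU); apply: le_lt_trans (hsq_congr _ _ hU) _.
have dk k : (d - const_mx 1) 0 k ^+ 2 <= s ^+ 2.
  have lk : `|ln (d 0 k)| < ln (1 + s).
    apply: le_lt_trans H; rewrite -sqrtr_sqr ler_sqrt; last first.
      by apply: sumr_ge0 => j _; rewrite sqr_ge0.
    by rewrite (bigD1 k) //= lerDl sumr_ge0 // => j _; rewrite sqr_ge0.
  move: lk; rewrite ltr_norml => /andP[l1 l2].
  have d1 : d 0 k < 1 + s by move: l2; rewrite ltr_ln ?posrE //; lra.
  have d2 : (1 + s)^-1 < d 0 k.
    by move: l1; rewrite -lnV ?posrE ?ltr_ln ?posrE ?invr_gt0 //; lra.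
  have d3 : 1 - s <= (1 + s)^-1.
    by rewrite -[leRHS]mul1r ler_pdivlMr; [nra|lra].
  by rewrite !mxE -ler_sqrt ?sqr_ge0 // !sqrtr_sqr (@ger0_norm _ s) ?(ltW s0) // ler_norml; apply/andP; split; lra.
apply: le_lt_trans (_ : m%:R * s ^+ 2 * hsq (adjm P *m P) < eta).
  apply: ler_wpM2r; first exact: hsq_gram_ge0.
  apply: le_trans (ler_sum _ (fun k _ => dk k)) _.
  by rewrite sumr_const card_ord mulr_natl.
by rewrite mulrAC -/K; nra.
Qed.

Lemma rdist_lt_of_hsq B (eps : R) : posdef B -> 0 < eps ->
  exists2 eta : R, 0 < eta &
  forall A, posdef A -> hsq (A - B) < eta -> rdist B A < eps.
Proof.
move=> hB eps0; have [P hP <-] := posdef_sqrt hB.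
pose G := hsq (adjm (invmx P) *m invmx P).
have G0 : 0 <= G := hsq_gram_ge0 _.
(* The bound [2^-1] keeps the eigenvalues of [W] above [2^-1], where [ln] is 2-Lipschitz; [eps / 2]
   absorbs this factor 2. *)
pose s := Num.min 2^-1 (eps / 2).
have s0 : 0 < s by rewrite lt_min invr_gt0 ltr0n divr_gt0.
have sh : s <= 2^-1 by rewrite ge_min lexx.
have se : s <= eps / 2 by rewrite ge_min lexx orbT.
exists (s ^+ 2 / (G + 1)); first by rewrite divr_gt0 ?exprn_gt0 // ltr_wpDl.
move=> A hA; have [W hW AE] := posdef_frame hP hA.
rewrite ltr_pdivlMr ?ltr_wpDl // => H.
have hW1 : hsq (W - 1%:M) < s ^+ 2.
  have hH : adjm (A - P *m adjm P) = A - P *m adjm P.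
    by rewrite adjmB adjm_mul adjmK hA.1.
  have WE : W - 1%:M = invmx P *m (A - P *m adjm P) *m adjm (invmx P).
    rewrite mulmx_congrB AE !mulmxA (mulVmx hP) mul1mx -!mulmxA -adjm_mul (mulVmx hP).
    by rewrite adjm1 !mulmx1.
  rewrite WE; apply: le_lt_trans (hsq_congr_le _ hH) _; rewrite -/G.
  by apply: le_lt_trans H; rewrite ler_wpM2l ?hsq_ge0 // lerDl.
rewrite AE (rdist_frame hP hW); move: hW1.
have [U [d [hU d0 ->]]] := (posdefP _).1 hW.
rewrite (sdm_sub1 _ hU) (hsq_sdm _ hU) (lognorm_sdm _ hU) => S1.
have dk k : ln (d 0 k) ^+ 2 <= 2 ^+ 2 * (d - const_mx 1) 0 k ^+ 2.
  rewrite !mxE -exprMn.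
  have : (d 0 k - 1) ^+ 2 < s ^+ 2.
    apply: le_lt_trans S1; rewrite (bigD1 k) //= !mxE lerDl.
    by apply: sumr_ge0 => j _; rewrite sqr_ge0.
  rewrite -ltr_sqrt ?exprn_gt0 // !sqrtr_sqr (gtr0_norm s0) ltr_norml => /andP[d1 d2].
  have H2 : `|ln (d 0 k) - ln 1| <= (2^-1)^-1 * `|d 0 k - 1|.
    by apply: ln_lipschitz; rewrite ?invr_gt0 ?ltr0n //; lra.
  move: H2; rewrite ln1 subr0 invrK => H2.
  rewrite -[leLHS]real_normK ?num_real // -[leRHS]real_normK ?num_real //.
  by rewrite lerXn2r ?nnegrE // normrM (@ger0_norm _ 2).
apply: le_lt_trans (_ : Num.sqrt (2 ^+ 2 * \sum_k (d - const_mx 1) 0 k ^+ 2) < eps).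
  rewrite ler_sqrt; first by rewrite mulr_sumr; apply: ler_sum => k _; exact: dk.
  by rewrite mulr_ge0 ?sqr_ge0 // sumr_ge0 // => k _; rewrite sqr_ge0.
rewrite sqrtrM ?sqr_ge0 // sqrtr_sqr (@ger0_norm _ 2) //.
have : Num.sqrt (\sum_k (d - const_mx 1) 0 k ^+ 2) < s.
  by rewrite -[ltRHS](gtr0_norm s0) -sqrtr_sqr ltr_sqrt ?exprn_gt0.
lra.
Qed.

Lemma hsq_mpow_le t B : posdef B -> exists2 L : R, 0 <= L & exists2 eta : R, 0 < eta &
  forall A, posdef A -> hsq (A - B) < eta ->
    hsq (mpow t A - mpow t B) <= L * hsq (A - B).
Proof.
move=> /posdefP[V [e [hV e0 ->]]]; have [c c0 ce] := row_lower_bound e0.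
(* The eigenvalues of [A] and of [B] all lie between [c / 2] and [b], where the power is
   Lipschitz. *)
pose b := c + \sum_k e 0 k.
have eb k : e 0 k + c <= b.
  rewrite /b addrC lerD2l (bigD1 k) //= lerDl sumr_ge0 // => j _; exact: ltW.
have c20 : 0 < c / 2 by lra.
have [L L0 HL] := powR_lipschitz t b c20.
exists (L ^+ 2); first exact: sqr_ge0.
exists ((c / 2) ^+ 2); first by rewrite exprn_gt0.
move=> A /posdefP[U [d [hU d0 ->]]] H.
rewrite !(mpow_sdm _ _ hU) !(mpow_sdm _ _ hV) !(hsq_sub_sdm _ _ hU hV).
rewrite mulr_sumr; apply: ler_sum => i _; rewrite mulr_sumr; apply: ler_sum => j _.
rewrite [leRHS]mulrCA ler_wpM2l ?overlap_ge0 // !mxE -exprMn.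
have [k] := near_eigenvalue i hU hV (ltW c20) H.
rewrite ltr_norml => /andP[k1 k2].
rewrite -[leLHS]real_normK ?num_real // -[leRHS]real_normK ?num_real //.
rewrite lerXn2r ?nnegrE // [leRHS]normrM (ger0_norm L0); apply: HL.
  by have := ce k; have := eb k; lra.
by have := ce j; have := eb j; lra.
Qed.

Lemma rdist_congr Q A B : Q \in unitmx -> posdef A -> posdef B ->
  rdist (Q *m A *m adjm Q) (Q *m B *m adjm Q) = rdist A B.
Proof.
move=> hQ hA hB; have [P hP AE] := posdef_sqrt hA.
have [Z hZ BE] := posdef_frame hP hB.
have -> : rdist A B = lognorm Z by rewrite BE -AE; exact: rdist_frame.
have hQP : Q *m P \in unitmx by rewrite unitmx_mul hQ hP.
by rewrite -(rdist_frame hQP hZ) adjm_mul BE -AE !mulmxA.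
Qed.

(** In the frame [Q^(1/2)] the map is a power. Its continuity is proved for the Frobenius norm and
    carried over to the distance near a fixed point. *)
Lemma gmean_continuous Q B t (eps : R) : posdef Q -> posdef B -> 0 < eps ->
  exists2 del : R, 0 < del & forall A, posdef A -> rdist B A < del ->
    rdist (gmean Q B t) (gmean Q A t) < eps.
Proof.
move=> hQ hB eps0; have hP := mpow_unit 2^-1 hQ.
have [W hW ->] := posdef_frame hP hB.
have [eta eta0 H1] := rdist_lt_of_hsq (mpow_posdef t hW) eps0.
have [L L0 [eta1 eta10 H2]] := hsq_mpow_le t hW.
have eta20 : 0 < Num.min eta1 (eta / (L + 1)).
  by rewrite lt_min eta10 divr_gt0 // ltr_wpDl.
have [del del0 H3] := hsq_lt_of_rdist hW eta20.
exists del => // A hA; have [Z hZ ->] := posdef_frame hP hA.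
rewrite (rdist_congr hP hW hZ) => /(H3 _ hZ); rewrite lt_min => /andP[h1].
rewrite ltr_pdivlMr ?ltr_wpDl // => h2.
rewrite !(gmean_frame _ hQ) // (rdist_congr hP); [|exact: mpow_posdef..].
apply: H1; first exact: mpow_posdef.
apply: le_lt_trans (H2 _ hZ h1) _; apply: le_lt_trans h2.
rewrite mulrC ler_wpM2l ?lerDl //; apply: hsq_ge0.
by rewrite adjmB hZ.1 hW.1.
Qed.

End PowerContinuity.

(** * Wasserstein estimates *)

Section PushforwardIntegral.
Context {R : realType} d1 d2 (T1 : measurableType d1) (T2 : measurableType d2).
Local Open Scope ereal_scope.
Import HBNNSimple.

(** The simple functions below [f] are among those below [g], and the integrals are suprema over
    these families. *)
Lemma integral_le_nonmeasurable (mu : {measure set T1 -> \bar R}) (f g : T1 -> \bar R) :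
  (forall x, 0 <= f x) -> (forall x, f x <= g x) ->
  \int[mu]_x f x <= \int[mu]_x g x.
Proof.
move=> f0 fg; rewrite !ge0_integralTE //; last by move=> x; exact: le_trans (fg x).
by apply: ereal_sup_le => _ [h hf <-]; exists h => // x; exact: le_trans (fg x).
Qed.

Lemma exists_pushforward_probability (P : probability T1 R) (phi : T1 -> T2) :
  measurable_fun setT phi ->
  exists Q : probability T2 R, forall A, Q A = P (phi @^-1` A).
Proof.
move=> mphi.
pose mm := isMeasurableFun.Build _ _ _ _ _ mphi.
pose X : {mfun T1 >-> T2} := HB.pack phi mm.
by exists (distribution P X).
Qed.

(* Also holds for non-measurable [f], whose integral is the supremum of the
   integrals of the simple functions below it. *)
Lemma integral_pushforward_le (P : {measure set T1 -> \bar R})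
    (Q : {measure set T2 -> \bar R}) (phi : T1 -> T2) (f : T2 -> \bar R) (c : \bar R) :
  measurable_fun setT phi -> (forall A, Q A = P (phi @^-1` A)) ->
  (forall y, 0 <= f y) ->
  (forall k : T1 -> R, measurable_fun setT k -> (forall x, (0 <= k x)%R) ->
     (forall x, (k x)%:E <= f (phi x)) -> \int[P]_x (k x)%:E <= c) ->
  \int[Q]_y f y <= c.
Proof.
move=> mphi QE f0 H; rewrite ge0_integralTE //; apply: ge_ereal_sup => _ [h hf <-].
have mh : measurable_fun setT h by [].
have h0 y : (0 <= h y)%R by exact: fun_ge0.
rewrite -integralT_nnsfun.
rewrite (eq_measure_integral (pushforward P phi)); last by move=> A _ _; exact: QE.
rewrite ge0_integral_pushforward //.
- by apply: (H (h \o phi)) => // [|x]; [exact: measurableT_comp|exact: hf].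
- exact/measurable_EFinP.
- by move=> y _; rewrite lee_fin.
Qed.

End PushforwardIntegral.

Lemma integral_add3_le {R : realType} d (T : measurableType d)
    (P : probability T R) (a c1 c2 : R) (k g h : T -> R) : 0 <= a -> 0 <= c1 -> 0 <= c2 ->
  measurable_fun setT k -> measurable_fun setT g -> measurable_fun setT h ->
  (forall z, 0 <= k z) -> (forall z, 0 <= g z) -> (forall z, 0 <= h z) ->
  (forall z, k z <= a + c1 * g z + c2 * h z) ->
  (\int[P]_z (k z)%:E <= a%:E + c1%:E * \int[P]_z (g z)%:E
     + c2%:E * \int[P]_z (h z)%:E)%E.
Proof.
move=> a0 c10 c20 mk mg mh k0 g0 h0 kle.
have mg' : measurable_fun setT (fun z => (g z)%:E) by exact/measurable_EFinP.
have mh' : measurable_fun setT (fun z => (h z)%:E) by exact/measurable_EFinP.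
rewrite -!ge0_integralZl_EFin //; try by move=> z _; rewrite lee_fin.
have -> : (a%:E = \int[P]_z (cst a%:E z))%E.
  by rewrite integral_cst // -[RHS]/(_ * P setT)%E probability_setT mule1.
rewrite -!ge0_integralD //.
- apply: ge0_le_integral => //.
  + by move=> z _; rewrite lee_fin.
  + exact/measurable_EFinP.
  + by apply: emeasurable_funD; [apply: emeasurable_funD => //|]; exact: measurable_funeM.
  + by move=> z _; rewrite -!EFinM -!EFinD lee_fin.
- by move=> z _; rewrite /= -!EFinM -!EFinD lee_fin addr_ge0 // mulr_ge0.
- by apply: emeasurable_funD => //; exact: measurable_funeM.
- by move=> z _; rewrite -!EFinM lee_fin mulr_ge0.
- exact: measurable_funeM.
- by move=> z _; rewrite -!EFinM lee_fin mulr_ge0.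
- exact: measurable_funeM.
Qed.

(** * Flows along geodesics issuing from a base point of a metric space *)

Section MetricFlow.
Context {R : realType} dd (T : measurableType dd).
Variables (dist : T -> T -> R) (X : T) (flow : R -> T -> T).
Hypothesis dist_ge0 : forall x y, 0 <= dist x y.
Hypothesis dist_xx : forall x, dist x x = 0.
Hypothesis dist_sym : forall x y, dist x y = dist y x.
Hypothesis dist_triangle : forall y x z, dist x z <= dist x y + dist y z.
Hypothesis open_measurable : forall U : set T,
  (forall x, U x -> exists2 e : R, 0 < e & [set y | dist x y < e] `<=` U) ->
  measurable U.
Hypothesis flow_norm : forall t x, dist X (flow t x) = `|t| * dist X x.
Hypothesis flow_dist : forall s t x, dist (flow s x) (flow t x) = `|t - s| * dist X x.
Hypothesis flow_measurable : forall t, measurable_fun setT (flow t).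
Hypothesis flow_cont : forall t x (e : R), 0 < e -> exists2 del : R, 0 < del &
  forall y, dist x y < del -> dist (flow t x) (flow t y) < e.

Lemma measurable_dist x : measurable_fun setT (dist x).
Proof.
apply: (measurability _ (RGenInftyO.measurableE R)) => /= _ [_ [a ->] <-].
rewrite setTI; apply: open_measurable => y; rewrite /= in_itv /= => ya.
exists (a - dist x y); first by rewrite subr_gt0.
move=> z /= yz; rewrite in_itv /=.
by apply: le_lt_trans (dist_triangle y _ _) _; rewrite -ltrBrDl.
Qed.

Lemma flow_jointly_continuous t0 x (e : R) : 0 < e -> exists2 del : R, 0 < del &
  forall t y, `|t - t0| < del -> dist x y < del ->
    dist (flow t0 x) (flow t y) < e.
Proof.
move=> e0; have e20 : 0 < e / 2 by lra.
have [del del0 H] := flow_cont t0 x e20.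
(* [K] bounds [dist X y] for [y] within 1 of [x], so changing the time costs at most
   [|t - t0| * K]. *)
pose K := dist X x + 1; have K0 : 0 < K by rewrite ltr_wpDl.
exists (Num.min del (Num.min 1 (e / 2 / K))).
  by rewrite !lt_min del0 ltr01 divr_gt0.
move=> t y; rewrite !lt_min => /andP[_ /andP[_ +]] /andP[yd /andP[y1 _]].
rewrite ltr_pdivlMr // => ht.
apply: le_lt_trans (dist_triangle (flow t0 y) _ _) _; rewrite flow_dist.
have := H _ yd; suff : `|t - t0| * dist X y <= e / 2 by lra.
apply: le_trans (ltW ht); rewrite ler_wpM2l //.
by apply: le_trans (dist_triangle x _ _) _; rewrite /K lerD2l ltW.
Qed.

(** Dominated convergence with dominating function [dist X]: each point eventually leaves the sets
    [F n]. *)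
Lemma exists_small_tail (mu : {measure set T -> \bar R}) (F : nat -> set T) (e : R) :
  0 < e -> (\int[mu]_x (dist X x)%:E < +oo)%E ->
  (forall n, measurable (F n)) ->
  (forall x, \forall n \near \oo, ~ F n x) ->
  exists n, (\int[mu]_x (dist X x * \1_(F n) x)%:E < e%:E)%E.
Proof.
move=> e0 fin mF Fx.
have mb := measurable_dist X.
have : ((fun n => \int[mu]_x (dist X x * \1_(F n) x)%:E) @ \oo --> \int[mu]_x (cst 0 x))%E.
  apply: (@dominated_cvg _ _ _ mu setT measurableT
    (fun n x => (dist X x * \1_(F n) x)%:E) (cst 0%E) (fun x => (dist X x)%:E)) => //.
  - by move=> n; apply/measurable_EFinP/measurable_funM => //; exact: measurable_indic.
  - move=> x _; apply: cvg_near_cst; apply: filterS (Fx x) => n nF.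
    by rewrite indicE memNset // mulr0.
  - apply/integrableP; split; first exact/measurable_EFinP.
    by under eq_integral do rewrite gee0_abs ?lee_fin ?dist_ge0 //.
  - move=> n x _; rewrite gee0_abs ?lee_fin ?mulr_ge0 ?dist_ge0 //.
    by rewrite ler_piMr ?dist_ge0 // indicE lern1 leq_b1.
rewrite integral0 => H.
have /H[n _ Hn] : nbhs 0%E [set y : \bar R | (y < e%:E)%E].
  by apply: open_nbhs_nbhs; split; [exact: open_ereal_lt_ereal|rewrite /= lte_fin].
by exists n; apply: Hn => /=.
Qed.

(* The points near which [flow] is [e]-continuous at scale [n.+1%:R^-1]; taking
   balls around [y'] instead of [y] alone makes this set open. *)
Let good t0 (e : R) n := [set y : T | exists y' r, dist y' y < r /\
  forall t x, `|t - t0| < n.+1%:R^-1 -> dist y' x < r + n.+1%:R^-1 ->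
    dist (flow t0 y') (flow t x) < e / 2].

(** Both images are compared with that of the centre [y'], at a cost of [e / 2] each. *)
Let good_dist t0 e n t x y : good t0 e n y -> `|t - t0| < n.+1%:R^-1 ->
  dist y x < n.+1%:R^-1 -> dist (flow t0 y) (flow t x) < e.
Proof.
have : (0 : R) < n.+1%:R^-1 by rewrite invr_gt0.
rewrite /good; move: (n.+1%:R^-1) => N N0 [y' [r [yr H]]] ht xy.
have h1 : dist (flow t0 y') (flow t x) < e / 2.
  by apply: H => //; have := dist_triangle y y' x; lra.
have h2 : dist (flow t0 y') (flow t0 y) < e / 2.
  by apply: H; [rewrite subrr normr0|lra].
have := dist_triangle (flow t0 y') (flow t0 y) (flow t x).
by rewrite (dist_sym _ (flow t0 y')); lra.
Qed.

Let good_measurable t0 e n : measurable (good t0 e n).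
Proof.
apply: open_measurable => y [y' [r [yr H]]].
exists (r - dist y' y); first by rewrite subr_gt0.
move=> z /= yz; exists y', r; split => //.
by have := dist_triangle y y' z; lra.
Qed.

Let good_eventually t0 (e : R) y : 0 < e -> \forall n \near \oo, good t0 e n y.
Proof.
move=> e0; have e20 : 0 < e / 2 by lra.
have [del del0 H] := flow_jointly_continuous t0 y e20.
(* One half of [del] serves as the radius of the ball, the other bounds the scale. *)
have d2 : 0 < del / 2 by lra.
have : \forall n \near \oo, (n.+1%:R^-1 : R) < del / 2.
  have := @cvg_harmonic R; move/cvgrPdist_lt => /(_ _ d2).
  by apply: filterS => n; rewrite sub0r normrN ger0_norm ?invr_ge0.
apply: filterS => n; rewrite /good; move: (n.+1%:R^-1) => N hN.
exists y, (del / 2); split; first by rewrite dist_xx.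
by move=> t x ht hx; apply: H; lra.
Qed.

Lemma flow_coupling_small (mu0 : probability T R) t0 (e : R) : 0 < e ->
  (\int[mu0]_x (dist X x)%:E < +oo)%E -> exists2 del : R, 0 < del &
  forall t (P : probability (T * T)%type R) (Q : probability (T * T)%type R),
    `|t - t0| < del ->
    (forall A, measurable A -> P (snd @^-1` A) = mu0 A) ->
    (\int[P]_z (dist z.1 z.2)%:E < del%:E)%E ->
    (forall A, Q A = P ((fun z => (flow t z.1, flow t0 z.2)) @^-1` A)) ->
    (\int[Q]_z (dist z.1 z.2)%:E < e%:E)%E.
Proof.
(* Three contributions of size [e1] add up to less than [e]. *)
move=> e0 fin; pose e1 := e / 4; have e10 : 0 < e1 by rewrite /e1; lra.
pose L := `|t0| + 1; have L0 : 0 < L by rewrite ltr_wpDl.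
pose b := dist X; have mb : measurable_fun setT b := measurable_dist X.
(* The bad set: the flow is not controlled at scale [n.+1%:R^-1], or the point is far from [X]. *)
pose F n := ~` good t0 e1 n `|` [set y | n%:R < b y].
have mF n : measurable (F n).
  apply: measurableU; first exact: measurableC.
  by rewrite -[X in measurable X]setTI; exact: measurable_fun_ltr (measurable_cst _) mb measurableT _ _.
have Fout y : \forall n \near \oo, ~ F n y.
  near=> n; move=> [|/=]; first by apply; near: n; exact: good_eventually.
  apply/negP; rewrite -leNgt; near: n; exact: nbhs_infty_ger.
have e2 : 0 < e1 / (2 * L) by rewrite divr_gt0 // mulr_gt0.
have [n small] := exists_small_tail e2 fin mF Fout.
pose N : R := n.+1%:R; have N0 : 0 < N by rewrite ltr0n.
(* Chosen so that [g <= dist z.1 z.2] below: [pos] is at most the distance and the indicator of [S]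
   at most [N] times the distance. *)
pose c := 1 + 2 * n%:R * N; have c0 : 0 < c by rewrite ltr_pwDl // !mulr_ge0.
(* The three bounds give [|t| <= L], the time scale required by [good_dist], and an integral of [g]
   small against its coefficient [L * c]. *)
exists (Num.min 1 (Num.min N^-1 (e1 / (L * c)))).
  by rewrite !lt_min ltr01 invr_gt0 N0 !divr_gt0 // mulr_gt0.
move=> t P Q; rewrite !lt_min => /andP[t1 /andP[tN _]] Psnd Pdist QE.
have tL : `|t| <= L.
  have -> : t = t0 + (t - t0) by ring.
  by apply: le_trans (ler_normD _ _) _; rewrite lerD2l ltW.
have t0L : `|t0| <= L by rewrite lerDl.
apply: (@le_lt_trans _ _ (3 * e1)%:E); last by rewrite lte_fin /e1; lra.
apply: (integral_pushforward_le _ QE).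
- by apply: measurable_fun_pair; apply: measurableT_comp.
- by move=> z; rewrite lee_fin.
move=> k mk k0 kle.
have {}kle z : k z <= dist (flow t z.1) (flow t0 z.2) by rewrite -lee_fin.
(* On [S] the second point is good and yet the image cost is at least [e1]; by [good_dist] the two
   points are then at least [N^-1] apart. *)
pose S := [set z : T * T | good t0 e1 n z.2 /\ e1 <= k z].
have mS : measurable S.
  have -> : S = snd @^-1` good t0 e1 n `&` k @^-1` `[e1, +oo[.
    by apply/seteqP; split => z /=; rewrite in_itv /= andbT.
  apply: measurableI; rewrite -[X in measurable X]setTI.
    by apply: measurable_snd => //; exact: good_measurable.
  by apply: mk => //; exact: measurable_itv.
(* [g] is bounded by the possibly non-measurable cost [dist z.1 z.2]. *)
pose pos z := Num.max 0 (b z.1 - b z.2).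
pose g (z : T * T) := c^-1 * (pos z + 2 * n%:R * \1_S z).
pose h (z : T * T) := b z.2 * \1_(F n) z.2.
have mg : measurable_fun setT g.
  apply: measurable_funM => //; apply: measurable_funD; last first.
    by apply: measurable_funM => //; exact: measurable_indic.
  by apply: measurable_maxr => //; apply: measurable_funB; exact: measurableT_comp.
have mbF : measurable_fun setT (fun y => b y * \1_(F n) y).
  by apply: measurable_funM => //; exact: measurable_indic.
have mh : measurable_fun setT h := measurableT_comp mbF measurable_snd.
have pos0 z : 0 <= pos z by rewrite le_max lexx.
have g0 z : 0 <= g z.
  by rewrite mulr_ge0 ?invr_ge0 ?(ltW c0) // addr_ge0 // !mulr_ge0.
have h0 z : 0 <= h z by rewrite mulr_ge0 // dist_ge0.
have g_le z : g z <= dist z.1 z.2.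
  rewrite /g mulrC ler_pdivrMr //.
  have posd : pos z <= dist z.1 z.2.
    rewrite ge_max dist_ge0 lerBlDl /=; have := dist_triangle z.2 X z.1.
    by rewrite (dist_sym z.2 z.1).
  have Sd : \1_S z <= N * dist z.1 z.2.
    rewrite indicE; case: (boolP (z \in S)) => [|_]; last by rewrite mulr_ge0 ?dist_ge0 ?(ltW N0).
    rewrite inE => -[gz kz]; rewrite mulrC -ler_pdivrMr // div1r leNgt.
    apply/negP; rewrite dist_sym => dz.
    have := good_dist gz tN dz; rewrite dist_sym => H.
    by have := lt_le_trans (le_lt_trans (kle z) H) kz; rewrite ltxx.
  have : 2 * n%:R * \1_S z <= 2 * n%:R * (N * dist z.1 z.2) by rewrite ler_wpM2l ?mulr_ge0.
  by rewrite /c; lra.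
(* When [k z > e1], the path through [X] gives [k z <= L * (pos z + 2 * b z.2)]. The term [b z.2] is
   charged to [h] on the bad set; elsewhere [z] lies in [S] and [b z.2 <= n]. *)
have k_le z : k z <= e1 + L * c * g z + 2 * L * h z.
  have cg : L * c * g z = L * (pos z + 2 * n%:R * \1_S z).
    by rewrite /g; field; rewrite gt_eqF.
  rewrite cg.
  have [ke|ek] := leP (k z) e1.
    apply: le_trans ke _; rewrite -addrA lerDl addr_ge0 // mulr_ge0 ?(ltW L0) //.
      by rewrite addr_ge0 // !mulr_ge0.
    by rewrite mulr_ge0 // ltW.
  have k1 : k z <= L * (pos z + 2 * b z.2).
    apply: le_trans (kle z) _.
    apply: le_trans (dist_triangle X _ _) _.
    rewrite (dist_sym _ X) !flow_norm -/b.
    have : b z.1 <= pos z + b z.2 by rewrite -lerBlDr le_max lexx orbT.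
    have : `|t| * b z.1 <= L * b z.1 by rewrite ler_wpM2r ?dist_ge0.
    have : `|t0| * b z.2 <= L * b z.2 by rewrite ler_wpM2r ?dist_ge0.
    nra.
  apply: le_trans k1 _.
  have [zF|zF] := pselect (F n z.2).
    rewrite /h [\1_(F n) _]indicE mem_set // mulr1.
    have : 0 <= L * (2 * n%:R * \1_S z) by rewrite !mulr_ge0 ?(ltW L0).
    by nra.
  have zS : S z.
    split; last exact: ltW.
    by apply: contrapT => ng; apply: zF; left.
  have bn : b z.2 <= n%:R by rewrite leNgt; apply/negP => bn; apply: zF; right.
  rewrite indicE mem_set // mulr1.
  have : 0 <= 2 * L * h z by rewrite mulr_ge0 ?h0 ?mulr_ge0 ?(ltW L0).
  have : L * b z.2 <= L * n%:R by rewrite ler_pM2l.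
  by nra.
have Lc0 : 0 < L * c by rewrite mulr_gt0.
have := integral_add3_le P (ltW e10) (ltW Lc0) (_ : 0 <= 2 * L) mk mg mh k0 g0 h0 k_le.
rewrite mulr_ge0 ?(ltW L0) // => /(_ isT)/le_trans; apply.
have Ig : (\int[P]_z (g z)%:E <= (e1 / (L * c))%:E)%E.
  apply: le_trans (integral_le_nonmeasurable P _ (g := fun z => (dist z.1 z.2)%:E) _) _.
  - by move=> z; rewrite lee_fin.
  - by move=> z; rewrite lee_fin.
  apply: le_trans (ltW Pdist) _; rewrite lee_fin.
  by rewrite !ge_min lexx !orbT.
have Ih : (\int[P]_z (h z)%:E <= (e1 / (2 * L))%:E)%E.
  (* [h] depends only on the second coordinate, whose law is the fixed measure [mu0]. *)
  apply: le_trans (ltW small).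
  rewrite [leRHS](@eq_measure_integral _ _ _ _ (pushforward P snd)); last first.
    by move=> A mA _; apply: esym; exact: Psnd.
  rewrite ge0_integral_pushforward //; last 2 first.
  - exact/measurable_EFinP.
  - by move=> y _; rewrite lee_fin mulr_ge0 // dist_ge0.
apply: le_trans (leeD (leeD (lexx _) (lee_wpmul2l _ Ig)) (lee_wpmul2l _ Ih)) _.
- by rewrite lee_fin ltW.
- by rewrite lee_fin mulr_ge0 // ltW.
rewrite -!EFinM -!EFinD lee_fin.
have -> : L * c * (e1 / (L * c)) = e1 by field; rewrite !gt_eqF.
have -> : 2 * L * (e1 / (2 * L)) = e1 by field; rewrite gt_eqF.
lra.
Unshelve. all: by end_near.
Qed.

End MetricFlow.

(** * The geodesic flow on the positive definite cone *)

HB.lock Definition pdist {R : realType} {m : nat} (A B : Pm R m) : R := dP A B.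

HB.lock Definition gflow {R : realType} {m : nat} (X : Pm R m) (t : R) (A : Pm R m)
  : Pm R m := gmeanP X A t.

Section PositiveCone.
Context {R : realType} {m : nat}.
Implicit Types (A B X : Pm R m) (t s e : R).

Lemma posdef_val A : posdef (val A).
Proof. exact: asboolW (valP A). Qed.

Lemma pdistE A B : pdist A B = rdist (val A) (val B).
Proof. by rewrite pdist.unlock rdist.unlock. Qed.

Lemma val_gflow X t A : val (gflow X t A) = gmean (val X) (val A) t.
Proof.
rewrite gflow.unlock /gmeanP val_insubd ifT //; apply: asboolT.
exact: gmean_posdef (posdef_val X) (posdef_val A).
Qed.

Lemma pdist_ge0 A B : 0 <= pdist A B.
Proof. by rewrite pdistE rdistE lognorm_ge0. Qed.

Lemma pdistxx A : pdist A A = 0.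
Proof. by rewrite pdistE (rdistxx (posdef_val A)). Qed.

Lemma pdistC A B : pdist A B = pdist B A.
Proof. by rewrite !pdistE; exact: rdistC (posdef_val A) (posdef_val B). Qed.

Lemma pdist_triangle B A X : pdist A X <= pdist A B + pdist B X.
Proof.
rewrite !pdistE.
exact: rdist_triangle (posdef_val A) (posdef_val B) (posdef_val X).
Qed.

Lemma pdist_gflow X s t A : pdist (gflow X s A) (gflow X t A) = `|t - s| * pdist X A.
Proof.
rewrite !pdistE !val_gflow; exact: rdist_gmean (posdef_val X) (posdef_val A).
Qed.

Lemma gflow0 X A : gflow X 0 A = X.
Proof.
apply: val_inj; rewrite val_gflow; have hX := posdef_val X.
have [Z hZ ->] := posdef_frame (mpow_unit 2^-1 hX) (posdef_val A).
by rewrite (gmean_frame _ hX hZ) (mpow0 hZ) mulmx1 (mpow_adjm_half hX).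
Qed.

Lemma pdist_gflow_base X t A : pdist X (gflow X t A) = `|t| * pdist X A.
Proof. by rewrite -{1}(gflow0 X A) pdist_gflow subr0. Qed.

Lemma gflowM X A t s : gflow X s (gflow X t A) = gflow X (t * s) A.
Proof.
apply: val_inj; rewrite !val_gflow.
exact: gmeanM (posdef_val X) (posdef_val A).
Qed.

Lemma gflow_continuous X t A e : 0 < e -> exists2 del : R, 0 < del &
  forall B, pdist A B < del -> pdist (gflow X t A) (gflow X t B) < e.
Proof.
move=> e0.
have [del del0 H] := gmean_continuous t (posdef_val X) (posdef_val A) e0.
by exists del => // B; rewrite !pdistE !val_gflow => /(H _ (posdef_val B)).
Qed.

Lemma pdist_open_measurable (U : set (PmB R m)) :
  (forall x, U x -> exists2 e : R, 0 < e & [set y | pdist x y < e] `<=` U) ->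
  measurable U.
Proof. by rewrite pdist.unlock => H; apply: sub_sigma_algebra. Qed.

Lemma gflow_measurable X t :
  measurable_fun setT (gflow X t : PmB R m -> PmB R m).
Proof.
apply: (@measurability _ _ (PmB R m) (PmB R m) setT (gflow X t) (@dopen R m) erefl).
move=> _ [U oU <-]; rewrite setTI.
have {}oU A : U A -> exists2 e : R, 0 < e & [set y | pdist A y < e] `<=` U.
  by rewrite pdist.unlock; exact: oU.
apply: pdist_open_measurable => A /= /oU[e e0 eU].
have [del del0 H] := gflow_continuous X t A e0.
by exists del => // B /= /H; exact: eU.
Qed.

Lemma pdist_measurable X : measurable_fun setT (pdist X : PmB R m -> R).
Proof.
exact: (@measurable_dist R _ (PmB R m) (@pdist R m) pdist_triangle
  pdist_open_measurable X).
Qed.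

Lemma PhiE X t (mu : set (PmB R m) -> \bar R) : 
  Phi X t mu = pushforward mu (gflow X t : PmB R m -> PmB R m).
Proof. by rewrite gflow.unlock. Qed.

Lemma W1E (mu nu : set (PmB R m) -> \bar R) : W1 mu nu =
  ereal_inf [set (\int[pi]_z (pdist z.1 z.2)%:E)%E | pi in [set pi | coupling mu nu pi]].
Proof. by rewrite pdist.unlock. Qed.

(** The triangle inequality through [W] moves the finite first moment to the base point [X]; the
    constant [pdist X W] has a finite integral against a probability. *)
Lemma P1P X (mu : set (PmB R m) -> \bar R) : P1 mu ->
  exists2 P : probability (PmB R m) R, (P : set _ -> \bar R) = mu
    & (\int[P]_Z (pdist X Z)%:E < +oo)%E.
Proof.
move=> [[P /funext PE] [W]]; rewrite -PE => fin; exists P => //.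
have {}fin : (\int[P]_Z (pdist Z W)%:E < +oo)%E by rewrite pdist.unlock.
have mW : measurable_fun setT (fun Z : PmB R m => pdist Z W).
  by under eq_fun do rewrite pdistC; exact: pdist_measurable.
have le Z : pdist X Z <= pdist X W + 1 * pdist Z W + 0 * cst 0 Z.
  by rewrite mul0r addr0 mul1r (pdistC Z W); exact: pdist_triangle.
have := @integral_add3_le _ _ _ P (pdist X W) 1 0 (pdist X) (fun Z => pdist Z W) (cst 0)
  (pdist_ge0 X W) ler01 (lexx 0) (pdist_measurable X) mW (measurable_cst _)
  (pdist_ge0 X) (fun Z => pdist_ge0 Z W) (fun=> lexx 0) le.
rewrite mul0e adde0 mul1e => /le_lt_trans; apply.
by rewrite lte_add_pinfty ?ltry.
Qed.

End PositiveCone.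

(** * Push-forwards of measures along the flow *)

Unset Implicit Arguments.
Set Strict Implicit.
Set Printing Implicit Defensive.

Theorem theorem2p4 (R : realType) (m : nat) (X : Pm R m) :
  (* Phi_X maps R x P^1(P_m) into P^1(P_m) *)
  (forall (t : R) (mu : set (PmB R m) -> \bar R), P1 mu -> P1 (Phi X t mu)) /\
  (* Phi_X is continuous on R x P^1(P_m) (metric d_1^W on P^1) *)
  (forall (t0 : R) (mu0 : set (PmB R m) -> \bar R), P1 mu0 ->
     forall e : R, 0 < e -> exists2 del : R, 0 < del &
       forall (t : R) (mu : set (PmB R m) -> \bar R), P1 mu ->
         `|t - t0| < del -> (W1 mu mu0 < del%:E)%E ->
         (W1 (Phi X t mu) (Phi X t0 mu0) < e%:E)%E) /\
  (* flow-type identity *)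
  (forall (t s : R) (mu : set (PmB R m) -> \bar R), P1 mu ->
     Phi X (t * s) mu = Phi X s (Phi X t mu)) /\
  (* local Lipschitz property in t *)
  (forall mu : set (PmB R m) -> \bar R, P1 mu ->
     forall T : R, 0 < T -> exists2 C : R, 0 < C &
       forall t s : R, -T <= t <= T -> -T <= s <= T ->
         (W1 (Phi X t mu) (Phi X s mu) <= (C * `|t - s|)%:E)%E).
Proof.
have mdX : measurable_fun setT (fun Z : PmB R m => (pdist X Z)%:E).
  by apply/measurable_EFinP; exact (pdist_measurable X).
have dX0 Z : setT Z -> (0 <= (pdist X Z)%:E)%E by move=> _; rewrite lee_fin pdist_ge0.
split; [|split; [|split]].
- move=> t mu /(P1P X)[P <- fin]; have mt := gflow_measurable X t.
  have [Q QE] := exists_pushforward_probability P mt.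
  have <- : (Q : set _ -> \bar R) = Phi X t P by rewrite PhiE; exact/funext.
  split; first by exists Q.
  exists X; suff: (\int[Q]_Z (pdist Z X)%:E < +oo)%E by rewrite pdist.unlock.
  (* The flow scales distances from [X] by [|t|], hence also the first moment about [X]. *)
  apply: (@le_lt_trans _ _ (`|t|%:E * \int[P]_Z (pdist X Z)%:E)%E); last first.
    by rewrite lte_mul_pinfty // lee_fin.
  apply: (integral_pushforward_le mt QE).
    by move=> Z; rewrite lee_fin pdist_ge0.
  move=> k mk k0 kle; rewrite -ge0_integralZl_EFin //.
  apply: ge0_le_integral => //.
  + by move=> Z _; rewrite lee_fin.
  + exact/measurable_EFinP.
  + exact: measurable_funeM.
  by move=> Z _; apply: le_trans (kle Z) _; rewrite -EFinM pdistC pdist_gflow_base.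
- move=> t0 mu0 /(P1P X)[P0 <- fin] e e0.
  have [del del0 H] := @flow_coupling_small R _ (PmB R m) (@pdist R m) X (gflow X)
    pdist_ge0 pdistxx pdistC pdist_triangle pdist_open_measurable
    (pdist_gflow_base X) (pdist_gflow X) (gflow_measurable X)
    (gflow_continuous X) P0 t0 e e0 fin.
  exists del => // t mu _ tdel; rewrite !W1E => /ereal_inf_lt[_ [pi [pi1 pi2] <-] pidel].
  (* A coupling of cost below [del] is transported by the flow at time [t] in the first coordinate
     and at time [t0] in the second. *)
  have mphi : measurable_fun setT (fun z : PmB R m * PmB R m =>
      (gflow X t z.1 : PmB R m, gflow X t0 z.2 : PmB R m)).
    by apply: measurable_fun_pair; apply: (measurableT_comp (gflow_measurable X _)).
  have [Q QE] := exists_pushforward_probability pi mphi.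
  apply: le_lt_trans (H t pi Q tdel pi2 pidel QE).
  apply: ereal_inf_lbound; exists Q => //; split => A mA; rewrite PhiE QE.
    rewrite /pushforward -pi1 //.
    by rewrite -[X in measurable X]setTI; exact: gflow_measurable.
  rewrite /pushforward -pi2 //.
  by rewrite -[X in measurable X]setTI; exact: gflow_measurable.
- move=> t s mu _; rewrite !PhiE; apply/funext => A; rewrite /pushforward; congr (mu _).
  by apply/seteqP; split => B /=; rewrite gflowM.
- move=> mu /(P1P X)[P <- fin] T T0.
  set I := (\int[P]_Z (pdist X Z)%:E)%E in fin.
  have I0 : (0 <= I)%E by apply: integral_ge0 => Z _; rewrite lee_fin pdist_ge0.
  have IE : I = (fine I)%:E by rewrite fineK // ge0_fin_numE.
  have fI : 0 <= fine I by exact: fine_ge0.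
  (* The first moment about [X] is the Lipschitz constant; adding 1 makes it positive. *)
  exists (fine I + 1); first by rewrite ltr_wpDl.
  move=> t s _ _; rewrite W1E !PhiE.
  (* Each [Z] is coupled with itself: its images at the two times are exactly [|t - s| * pdist X Z]
     apart. *)
  have mphi : measurable_fun setT (fun Z : PmB R m =>
      (gflow X t Z : PmB R m, gflow X s Z : PmB R m)).
    by apply: measurable_fun_pair; exact: gflow_measurable.
  have [Q QE] := exists_pushforward_probability P mphi.
  apply: (@le_trans _ _ (\int[Q]_z (pdist z.1 z.2)%:E)%E).
    by apply: ereal_inf_lbound; exists Q => //; split => A mA; rewrite QE.
  apply: (integral_pushforward_le mphi QE).
    by move=> z; rewrite lee_fin pdist_ge0.
  move=> k mk k0 kle; apply: (@le_trans _ _ (`|t - s|%:E * I)%E); last first.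
    by rewrite IE -EFinM lee_fin mulrC ler_wpM2r // lerDl.
  rewrite -ge0_integralZl_EFin //.
  apply: ge0_le_integral => //.
  + by move=> Z _; rewrite lee_fin.
  + exact/measurable_EFinP.
  + exact: measurable_funeM.
  by move=> Z _; apply: le_trans (kle Z) _; rewrite -EFinM pdist_gflow distrC.
Qed.
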